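(* Let $k\geq 2$ be an integer. Given a finite set $V$ and a complete set of $k$-sets $\mathcal{S}_k,\overline{\mathcal{S}}_k$ on $V$, one can enumerate every connected triangle-free graph on $V$ that is consistent with $\mathcal{S}_k,\overline{\mathcal{S}}_k$ in time polynomial in $|V|$.
   Context: A $k$-set is a subset of size $k$. A complete set of $k$-sets on $V$ is a pair $(\mathcal{S}_k,\overline{\mathcal{S}}_k)$ with $\mathcal{S}_k\cup\overline{\mathcal{S}}_k=\binom{V}{k}$ and $\mathcal{S}_k\cap\overline{\mathcal{S}}_k=\emptyset$. For a graph $G$ on $V$, $\mathcal{S}_k(G)$ denotes the set of $k$-subsets of $V$ inducing a connected subgraph of $G$ and $\overline{\mathcal{S}}_k(G)$ the set of $k$-subsets inducing a disconnected subgraph. A graph $G$ on $V$ is consistent with $\mathcal{S}_k,\overline{\mathcal{S}}_k$ if $\mathcal{S}_k(G)=\mathcal{S}_k$ and $\overline{\mathcal{S}}_k(G)=\overline{\mathcal{S}}_k$. The integer $k$ is fixed (a constant). *)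

(* Defs.v *)
From HB Require Import structures.
From mathcomp Require Import all_boot all_order all_algebra.
Set Implicit Arguments.
Unset Strict Implicit.
Unset Printing Implicit Defensive.

Section Graphs.
Variable V : finType.

Record sgraph := SGraph {
  edges : {set {set V}};
  _ : [forall e in edges, #|e| == 2] }.

HB.instance Definition _ := [isSub for edges].
HB.instance Definition _ := [Finite of sgraph by <:].

Implicit Types (G : sgraph) (A : {set V}) (S T : {set {set V}}).

(* Irreflexive, since [set u; u] has a single element. *)
Definition adj G : rel V := [rel u v | [set u; v] \in edges G].

Definition triangle_free G : bool :=
  [forall u, forall v, forall w, ~~ [&& adj G u v, adj G v w & adj G u w]].

Definition induced_adj G A : rel V :=
  [rel u v | [&& u \in A, v \in A & adj G u v]].

(* The empty vertex set does not induce a connected graph. *)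
Definition induced_connected G A : bool :=
  (A != set0) && [forall u in A, forall v in A, connect (induced_adj G A) u v].

Definition connected_graph G : bool := induced_connected G [set: V].

Definition ksets (k : nat) : {set {set V}} := [set A : {set V} | #|A| == k].

Definition complete_ksets (k : nat) S T : Prop :=
  S :|: T = ksets k /\ S :&: T = set0.

Definition connected_ksets (k : nat) G : {set {set V}} :=
  [set A in ksets k | induced_connected G A].

Definition disconnected_ksets (k : nat) G : {set {set V}} :=
  [set A in ksets k | ~~ induced_connected G A].

Definition consistent (k : nat) S T G : Prop :=
  connected_ksets k G = S /\ disconnected_ksets k G = T.

(* Vertices are written as the numbers 0, ..., #|V| - 1.  A family of sets is
   written as its cardinality followed by the lists of elements of its members;
   an instance is the number of vertices followed by the two families. *)
Definition encode_vertex (v : V) : nat := enum_rank v.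

Definition encode_set A : seq nat := [seq encode_vertex v | v <- enum A].

Definition encode_family S : seq nat :=
  #|S| :: flatten [seq encode_set A | A <- enum S].

Definition encode_instance S T : seq nat :=
  #|V| :: encode_family S ++ encode_family T.

(* The adjacency matrix, row by row.  Every block has length #|V| ^ 2, so a
   concatenation of such blocks can be decoded when V is nonempty. *)
Definition encode_graph G : seq nat :=
  [seq nat_of_bool (adj G u v) | u <- enum V, v <- enum V].

Definition encode_graphs (Gs : seq sgraph) : seq nat :=
  flatten [seq encode_graph G | G <- Gs].

End Graphs.

(* Structured random-access machine: variables and arrays of natural numbers
   (a program names finitely many of each), a read-only random-access input
   and a write-only output.  Each operation has unit cost; as the only
   arithmetic operations are addition and truncated subtraction, a run of t
   steps only creates numbers of O(t) bits beyond the length of the input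
   entries and constants, hence polynomial time here coincides with polynomial
   time on Turing machines. *)
Inductive expr : Type :=
  | EConst of nat
  | EVar of nat
  | EGet of nat & expr
  | EInput of expr
  | EAdd of expr & expr
  | ESub of expr & expr.

Inductive cmd : Type :=
  | CSkip
  | CAssign of nat & expr
  | CStore of nat & expr & expr
  | CWrite of expr
  | CSeq of cmd & cmd
  | CIf of expr & cmd & cmd
  | CWhile of expr & cmd.

Record state : Type := State {
  vars : nat -> nat;
  arrays : nat -> nat -> nat;
  output : seq nat }.

Definition init_state : state := State (fun _ => 0) (fun _ _ => 0) [::].

Definition set_var (s : state) (x v : nat) : state :=
  State (fun y => if y == x then v else vars s y) (arrays s) (output s).

Definition set_array (s : state) (a i v : nat) : state :=
  State (vars s)
    (fun b j => if (b == a) && (j == i) then v else arrays s b j) (output s).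

Definition write (s : state) (v : nat) : state :=
  State (vars s) (arrays s) (rcons (output s) v).

Fixpoint eval (inp : seq nat) (s : state) (e : expr) : nat :=
  match e with
  | EConst c => c
  | EVar x => vars s x
  | EGet a e1 => arrays s a (eval inp s e1)
  | EInput e1 => nth 0 inp (eval inp s e1)
  | EAdd e1 e2 => eval inp s e1 + eval inp s e2
  | ESub e1 e2 => eval inp s e1 - eval inp s e2
  end.

Fixpoint cost (e : expr) : nat :=
  match e with
  | EConst _ | EVar _ => 1
  | EGet _ e1 | EInput e1 => (cost e1).+1
  | EAdd e1 e2 | ESub e1 e2 => (cost e1 + cost e2).+1
  end.

(* exec inp c s t s' : started in s on input inp, c halts in s' after t steps;
   tests succeed on nonzero values. *)
Inductive exec (inp : seq nat) : cmd -> state -> nat -> state -> Prop :=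
  | ExecSkip s : exec inp CSkip s 1 s
  | ExecAssign s x e :
      exec inp (CAssign x e) s (cost e).+1 (set_var s x (eval inp s e))
  | ExecStore s a e1 e2 :
      exec inp (CStore a e1 e2) s (cost e1 + cost e2).+1
        (set_array s a (eval inp s e1) (eval inp s e2))
  | ExecWrite s e :
      exec inp (CWrite e) s (cost e).+1 (write s (eval inp s e))
  | ExecSeq c1 c2 s1 s2 s3 t1 t2 :
      exec inp c1 s1 t1 s2 -> exec inp c2 s2 t2 s3 ->
      exec inp (CSeq c1 c2) s1 (t1 + t2) s3
  | ExecIfTrue e c1 c2 s s' t :
      eval inp s e != 0 -> exec inp c1 s t s' ->
      exec inp (CIf e c1 c2) s (cost e + t).+1 s'
  | ExecIfFalse e c1 c2 s s' t :
      eval inp s e = 0 -> exec inp c2 s t s' ->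
      exec inp (CIf e c1 c2) s (cost e + t).+1 s'
  | ExecWhileDone e c s :
      eval inp s e = 0 -> exec inp (CWhile e c) s (cost e).+1 s
  | ExecWhileStep e c s1 s2 s3 t1 t2 :
      eval inp s1 e != 0 -> exec inp c s1 t1 s2 ->
      exec inp (CWhile e c) s2 t2 s3 ->
      exec inp (CWhile e c) s1 (cost e + t1 + t2).+1 s3.

Definition runs (c : cmd) (inp : seq nat) (t : nat) (out : seq nat) : Prop :=
  exists2 s, exec inp c init_state t s & output s = out.

(* Main.v *)
(** Let G and H be connected triangle-free graphs with the same connected k-sets.
    Every edge inside a connected set of size at least k lies in a connected
    k-subset of it, so G and H have the same connected sets of each size at least
    k.  Comparing stars, a vertex of large degree has the same neighbours in G and
    H.  If u and w were adjacent in G only, then u, w and all their neighbours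
    would have small degree, so, in a graph with sufficiently many vertices,
    removing the neighbours of u and w would leave a component with at least k
    vertices; adding to it an adjacent neighbour of, say, u gives a connected set
    which sees u but not w, and such a set decides whether u and w are adjacent.
    Hence G = H as soon as the order is at least some N depending only on k.

    For at least N vertices the graph is therefore determined by its connected
    induced subgraphs of order N: u and v are adjacent iff some N-tuple of distinct
    vertices carries a connected triangle-free graph with the prescribed connected
    k-sets in which u and v are adjacent.  Since N is a constant, this is a
    first-order condition, evaluated by nested loops, and it yields one candidate
    graph.  For fewer than N vertices the constantly many candidates are part of
    the program.  Each candidate is checked before it is written. *)

Require Import Defs.
From mathcomp Require Import all_boot all_order all_algebra.
From mathcomp Require Import zify.
Set Implicit Arguments.
Unset Strict Implicit.
Unset Printing Implicit Defensive.

(** * Connected induced subgraphs *)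

Lemma card_bigcup_leq (I T : finType) (P : pred I) (F : I -> {set T}) :
  #|\bigcup_(i | P i) F i| <= \sum_(i | P i) #|F i|.
Proof.
apply: (big_ind2 (fun (X : {set T}) n => #|X| <= n)) => [|X m Y n Xm Yn|//].
  by rewrite cards0.
exact: leq_trans (leq_card_setU _ _) (leq_add Xm Yn).
Qed.

Section InducedConnectivity.
Variable V : finType.
Implicit Types (G H : sgraph V) (A B K Y : {set V}).

Lemma adj_sym G : symmetric (adj G).
Proof. by move=> u v; rewrite /adj /= setUC. Qed.

Lemma adj_irrefl G u : adj G u u = false.
Proof.
apply/negP => /= uu; case: G uu => E EP /= uu.
by have := forall_inP EP _ uu; rewrite setUid cards1.
Qed.

Lemma adj_neq G u v : adj G u v -> u != v.
Proof. by apply: contraTneq => ->; rewrite adj_irrefl. Qed.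

Lemma sgraph_ext G H : adj G =2 adj H -> G = H.
Proof.
move=> adjE; apply: val_inj; apply/setP => e /=.
have card2 F : e \in edges F -> #|e| = 2.
  by case: F => E EP /= /(forall_inP EP)/eqP.
apply/idP/idP => eE; have /eqP/cards2P[x [y [_ exy]]] := card2 _ eE.
  by have := adjE x y; rewrite /adj /= -exy eE => <-.
by have := adjE x y; rewrite /adj /= -exy eE => ->.
Qed.

Lemma induced_adjE G A u v :
  induced_adj G A u v = [&& u \in A, v \in A & adj G u v].
Proof. by []. Qed.

Lemma induced_connectedP G A :
  reflect (A != set0 /\ {in A &, forall u v, connect (induced_adj G A) u v})
          (induced_connected G A).
Proof.
apply: (iffP andP) => [[A0 /forall_inP h]|[A0 h]]; split=> //.
  by move=> u v uA vA; move/forall_inP: (h u uA); apply.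
by apply/forall_inP => u uA; apply/forall_inP => v vA; apply: h.
Qed.

Lemma induced_connect_sym G A : connect_sym (induced_adj G A).
Proof. by apply: sym_connect_sym => u v; rewrite !induced_adjE andbCA adj_sym. Qed.

Lemma induced_connectS G A B u v : A \subset B ->
  connect (induced_adj G A) u v -> connect (induced_adj G B) u v.
Proof.
move=> AB; apply: connect_sub => x y /and3P[xA yA xy]; apply: connect1.
by rewrite induced_adjE xy !(subsetP AB).
Qed.

Lemma induced_connected1 G u : induced_connected G [set u].
Proof.
apply/induced_connectedP; split=> [|x y /set1P -> /set1P -> //].
by apply/set0Pn; exists u; rewrite inE.
Qed.

Lemma induced_connectedU1 G A u v :
  induced_connected G A -> u \in A -> adj G u v -> induced_connected G (v |: A).
Proof.
case/induced_connectedP=> A0 cA uA uv; apply/induced_connectedP; split.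
  by apply/set0Pn; exists v; rewrite setU11.
have uP x : x \in v |: A -> connect (induced_adj G (v |: A)) u x.
  case/setU1P => [->|xA]; first by apply: connect1; rewrite induced_adjE setU11 uv setU1r.
  exact: induced_connectS (subsetUr _ _) (cA _ _ uA xA).
move=> x y xA yA; apply: connect_trans (uP y yA).
by rewrite induced_connect_sym uP.
Qed.

Lemma induced_connected_star G A u :
  {in A, forall v, adj G u v} -> induced_connected G (u |: A).
Proof.
move=> uA; apply/induced_connectedP; split.
  by apply/set0Pn; exists u; rewrite setU11.
have uP x : x \in u |: A -> connect (induced_adj G (u |: A)) u x.
  case/setU1P => [-> //|xA]; apply: connect1.
  by rewrite induced_adjE setU11 setU1r ?[adj _ _ _]uA.
move=> x y xA yA; apply: connect_trans (uP y yA).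
by rewrite induced_connect_sym uP.
Qed.

(** Without such an edge [A] would be closed under adjacency inside [Y], so no path inside [Y] could
    lead from [A] to a vertex of [Y] outside it. *)
Lemma induced_connected_leaving G Y A :
  induced_connected G Y -> A \subset Y -> A != set0 -> A != Y ->
  exists a y, [/\ a \in A, y \in Y :\: A & adj G a y].
Proof.
case/induced_connectedP=> _ cY AY /set0Pn[a aA] nAY.
have [y yY yA] : exists2 y, y \in Y & y \notin A.
  by apply/subsetPn; apply: contra nAY => YA; rewrite eqEsubset AY.
have [/existsP[b /existsP[z /and3P[]]]|] :=
  boolP [exists b, exists z, [&& b \in A, z \in Y :\: A & adj G b z]].
  by exists b, z; split.
move=> none; have clA : closed (induced_adj G Y) (mem A).
  apply: (intro_closed (induced_connect_sym G Y)) => b z /and3P[_ zY bz] bA.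
  apply: contraNT none => zA; apply/existsP; exists b; apply/existsP; exists z.
  by rewrite [b \in A]bA bz !inE zA zY.
have := closed_connect clA (cY a y (subsetP AY _ aA) yY).
by rewrite [a \in mem A]aA [y \in mem A](negbTE yA).
Qed.

Lemma induced_connected_nbr G A u v :
  induced_connected G A -> u \in A -> v \in A -> v != u ->
  exists2 x, x \in A & adj G u x.
Proof.
move=> cA uA vA vu.
have [|||a [x [/set1P -> /setDP[xA _] ux]]] :=
  @induced_connected_leaving G A [set u] cA.
- by rewrite sub1set.
- by apply/set0Pn; exists u; rewrite inE.
- by apply: contraNneq vu => E; move: vA; rewrite -E inE.
by exists x.
Qed.

(** Vertices are added one at a time: as long as the set is a proper subset of [Y], an edge leaves
    it inside [Y], and its far end can be added. *)
Lemma induced_connected_grow G Y A m :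
  induced_connected G Y -> induced_connected G A -> A \subset Y ->
  #|A| <= m -> m <= #|Y| ->
  exists K, [/\ induced_connected G K, A \subset K, K \subset Y & #|K| = m].
Proof.
move=> cY; elim: m A => [|m IHm] A cA AY leAm lemY.
  by case/induced_connectedP: cA => /set0Pn[x xA] _;
    move: leAm; rewrite (cardD1 x) xA.
have [cardA|ltA] := eqVneq #|A| m.+1; first by exists A; split.
have [|K [cK AK KY cardK]] := IHm A cA AY _ (ltnW lemY); first by lia.
have [||a [y [aK /setDP[yY yK] ay]]] := induced_connected_leaving cY KY.
- by case/induced_connectedP: cK.
- by apply: contraTneq lemY => <-; rewrite cardK ltnn.
exists (y |: K); split.
- exact: induced_connectedU1 ay.
- by apply: subset_trans AK _; apply: subsetUr.
- by rewrite subUset sub1set yY.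
- by rewrite cardsU1 yK cardK.
Qed.

(** An edge of [G] inside [Y] grows to a [G]-connected [k]-subset of [Y]. That subset is also
    [H]-connected, so the ends of the edge are joined in [H] within [Y]; each edge of a path in [G]
    is replaced in this way. *)
Lemma connected_ksets_transfer G H k Y : 2 <= k ->
  (forall K, K \subset Y -> #|K| = k ->
     induced_connected G K -> induced_connected H K) ->
  k <= #|Y| -> induced_connected G Y -> induced_connected H Y.
Proof.
move=> k2 GH kY cY; have /induced_connectedP[Y0 cY'] := cY.
apply/induced_connectedP; split=> // u v uY vY.
apply: (connect_sub _ (cY' u v uY vY)) => x y /and3P[xY yY xy].
have cxy : induced_connected G (y |: [set x]).
  by apply: induced_connectedU1 xy; rewrite ?induced_connected1 ?inE.
have [||K [cK xyK KY cardK]] := induced_connected_grow cY cxy _ _ kY.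
- by rewrite subUset !sub1set yY.
- by apply: leq_trans k2; rewrite cardsU1 cards1; case: (_ \notin _).
have /induced_connectedP[_ cK'] := GH K KY cardK cK.
by apply: induced_connectS KY (cK' _ _ _ _); apply: (subsetP xyK); rewrite !inE eqxx ?orbT.
Qed.

Lemma triangle_freeP G u v w : triangle_free G ->
  adj G u v -> adj G v w -> adj G u w -> False.
Proof.
move=> /forallP/(_ u)/forallP/(_ v)/forallP/(_ w)/negP tf uv vw uw.
by apply: tf; apply/and3P; split.
Qed.

End InducedConnectivity.

(** * Large graphs are determined by their connected k-sets *)

Section Uniqueness.
Variables (V : finType) (k : nat).
Hypothesis k_gt1 : 2 <= k.
Implicit Types (G H : sgraph V) (A B K : {set V}).

Definition nbh G u : {set V} := [set v | adj G u v].

Definition same_connected G H :=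
  forall A, k <= #|A| -> induced_connected G A = induced_connected H A.

Lemma same_connected_sym G H : same_connected G H -> same_connected H G.
Proof. by move=> GH A kA; rewrite GH. Qed.

(** Let [y] be adjacent to [x] in [G] only, and split the common neighbours of [x] into those
    adjacent to [y] in [H], [M], and the rest, [N]; one part has at least [k] elements. If it is
    [N], then [x], [y] and [N] form a set connected in [G] in which [y] is isolated in [H]. If it is
    [M], then [y] and [M] form a star in [H], while in [G] an edge from [y] to [M] would close a
    triangle with [x]. *)
Lemma common_star_sub G H x : triangle_free G -> same_connected G H ->
  2 * k <= #|nbh G x :&: nbh H x| -> nbh G x \subset nbh H x.
Proof.
move=> tfG GH big; apply/subsetP => y; rewrite !inE => xyG.
apply/negPn/negP => xyH.
have yx : y != x by rewrite eq_sym (adj_neq xyG).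
pose L := nbh G x :&: nbh H x; pose N := L :\: nbh H y; pose M := L :&: nbh H y.
have yL : y \notin L by rewrite !inE (negbTE xyH) andbF.
have cardL : #|M| + #|N| = #|L| by rewrite cardsID.
have [bigN|bigM] : k <= #|N| \/ k <= #|M|.
  by have : 2 * k <= #|L| by []; lia.
  have cG : induced_connected G (y |: (x |: N)).
    apply: induced_connectedU1 xyG; rewrite ?setU11 //.
    by apply: induced_connected_star => z; rewrite !inE => /and3P[_ ->].
  have : induced_connected H (y |: (x |: N)).
    rewrite -GH //; apply: leq_trans bigN _; apply: subset_leq_card.
    by rewrite setUA subsetUr.
  case/induced_connected_nbr/(_ (setU11 _ _) (setU1r _ (setU11 x N))) => [|z].
    by rewrite eq_sym.
  rewrite !inE => /or3P[/eqP->|/eqP->|/andP[/negP //]].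
    by rewrite adj_irrefl.
  by rewrite adj_sym (negbTE xyH).
have cH : induced_connected H (y |: M).
  by apply: induced_connected_star => z; rewrite !inE => /andP[_ ->].
have /set0Pn[z zM] : M != set0 by rewrite -card_gt0; lia.
have zy : z != y by apply: contraNneq yL => <-; case/setIP: zM.
have : induced_connected G (y |: M).
  by rewrite GH //; apply: leq_trans bigM _; apply/subset_leq_card/subsetUr.
case/induced_connected_nbr/(_ (setU11 _ _) (setU1r _ zM) zy) => t.
rewrite !inE => /orP[/eqP->|/andP[/andP[xt _] _] yt].
  by rewrite adj_irrefl.
exact: triangle_freeP tfG xyG yt xt.
Qed.

(** At least [k] private [G]-neighbours would form with [x] a star in [G] in which [x] is isolated
    in [H]. Hence fewer than [k] are private, at least [2 * k] are common, and [common_star_sub]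
    applies in both directions. *)
Lemma large_degree_nbh G H x : triangle_free G -> triangle_free H ->
  same_connected G H -> 3 * k <= #|nbh G x| -> nbh G x = nbh H x.
Proof.
move=> tfG tfH GH big.
have cardL : #|nbh G x :&: nbh H x| + #|nbh G x :\: nbh H x| = #|nbh G x|.
  by rewrite cardsID.
have small : #|nbh G x :\: nbh H x| < k.
  rewrite ltnNge; apply/negP => bigD.
  have cG : induced_connected G (x |: (nbh G x :\: nbh H x)).
    by apply: induced_connected_star => z; rewrite !inE => /andP[_ ->].
  have /set0Pn[z zD] : nbh G x :\: nbh H x != set0 by rewrite -card_gt0; lia.
  have zx : z != x.
    by move: zD; rewrite !inE eq_sym => /andP[_] /adj_neq.
  have : induced_connected H (x |: (nbh G x :\: nbh H x)).
    by rewrite -GH //; apply: leq_trans bigD _; apply/subset_leq_card/subsetUr.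
  case/induced_connected_nbr/(_ (setU11 _ _) (setU1r _ zD) zx) => t.
  rewrite !inE => /orP[/eqP->|/andP[/negP //]].
  by rewrite adj_irrefl.
apply/eqP; rewrite eqEsubset; apply/andP; split.
  by apply: common_star_sub => //; lia.
by apply: common_star_sub => //; [exact: same_connected_sym|rewrite setIC; lia].
Qed.

Lemma nonadj_small_degree G H u w : triangle_free G -> triangle_free H ->
  same_connected G H -> adj G u w -> ~~ adj H u w -> #|nbh G u| < 3 * k.
Proof.
move=> tfG tfH GH uwG; rewrite ltnNge; apply: contra => big.
have /setP/(_ w) := large_degree_nbh tfG tfH GH big.
by rewrite !inE uwG => <-.
Qed.

(* Otherwise w, x and the G-neighbours of x not H-adjacent to w form a set that
   is connected in G, as it contains u, whereas w is isolated in it in H. *)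
Lemma nonadj_nbr_small_degree G H u w x : triangle_free G -> triangle_free H ->
  same_connected G H -> adj G u w -> ~~ adj H u w -> adj G u x ->
  #|nbh G x| < 4 * k.
Proof.
move=> tfG tfH GH uwG uwH uxG; rewrite ltnNge; apply/negP => big.
have degwG : #|nbh G w| < 3 * k.
  by apply: (@nonadj_small_degree G H w u); rewrite // adj_sym.
have degwH : #|nbh H w| < 3 * k.
  rewrite ltnNge; apply/negP => bigw.
  have /setP/(_ u) := large_degree_nbh tfH tfG (same_connected_sym GH) bigw.
  by rewrite !inE adj_sym (negbTE uwH) adj_sym uwG.
have xE : nbh G x = nbh H x by apply: large_degree_nbh => //; lia.
have xw : w != x by apply: contraTneq degwG => ->; rewrite -leqNgt; lia.
have xwG : ~~ adj G x w by apply/negP => xwG; apply: triangle_freeP tfG uxG xwG uwG.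
have xwH : ~~ adj H x w by move/setP/(_ w): xE; rewrite !inE => <-.
pose L := nbh G x :\: nbh H w.
have uL : u \in L by rewrite !inE adj_sym uwH adj_sym.
have cardL : k <= #|L|.
  have := cardsID (nbh H w) (nbh G x); rewrite -/L.
  by have := subset_leq_card (subsetIr (nbh G x) (nbh H w)); lia.
have cG : induced_connected G (w |: (x |: L)).
  apply: induced_connectedU1 uwG; rewrite ?(setU1r _ uL) //.
  by apply: induced_connected_star => z; rewrite !inE => /andP[_].
have : induced_connected H (w |: (x |: L)).
  rewrite -GH //; apply: leq_trans cardL _; apply: subset_leq_card.
  by rewrite setUA subsetUr.
case/induced_connected_nbr/(_ (setU11 _ _) (setU1r _ (setU11 x L))) => [|z].
  by rewrite eq_sym.
rewrite !inE => /or3P[/eqP->|/eqP->|/andP[/negP //]].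
  by rewrite adj_irrefl.
by rewrite adj_sym (negbTE xwH).
Qed.

(** Adding [u] and then [w] to [B] keeps it connected in [G], hence in [H], so [w] has an
    [H]-neighbour in [u |: B]. It cannot lie in [B]: otherwise [w |: B] would be connected in [H]
    and therefore in [G], where [w] has no neighbour in [B]. *)
Lemma separating_set_adj G H B u w : same_connected G H ->
  k <= #|B| -> induced_connected G B -> adj G u w -> w \notin B ->
  (exists2 x, x \in B & adj G x u) -> (forall x, x \in B -> ~~ adj G x w) ->
  adj H u w.
Proof.
move=> GH kB cB uwG wB [x xB xu] wN.
have cBH : induced_connected H B by rewrite -GH.
have cu : induced_connected G (u |: B) by apply: induced_connectedU1 xu.
have cuw : induced_connected G (w |: (u |: B)).
  by apply: induced_connectedU1 uwG; rewrite ?setU11.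
have : induced_connected H (w |: (u |: B)).
  by rewrite -GH //; apply: leq_trans kB _; rewrite setUA;
     apply/subset_leq_card/subsetUr.
case/induced_connected_nbr/(_ (setU11 _ _) (setU1r _ (setU11 u B))) => [|z].
  exact: adj_neq uwG.
rewrite !inE => /or3P[/eqP->|/eqP->|zB wz].
- by rewrite adj_irrefl.
- by rewrite adj_sym.
have : induced_connected G (w |: B).
  rewrite GH; first by apply: induced_connectedU1 zB _; rewrite // adj_sym.
  by apply: leq_trans kB _; apply/subset_leq_card/subsetUr.
case/induced_connected_nbr/(_ (setU11 _ _) (setU1r _ zB)) => [|t].
  by apply: contraNneq wB => <-.
rewrite !inE => /orP[/eqP->|/wN /negP tw wt].
  by rewrite adj_irrefl.
by case: tw; rewrite adj_sym.
Qed.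

(** Chosen to exceed the bound [6 * k + 24 * k ^ 3] that arises in [same_connected_adj] when all
    components are small. *)
Definition large_order := 100 * k ^ 3.

Lemma same_connected_adj G H u w : large_order <= #|V| -> connected_graph G ->
  triangle_free G -> triangle_free H -> same_connected G H ->
  adj G u w -> adj H u w.
Proof.
move=> large cG tfG tfH GH uwG; apply/negPn/negP => uwH.
have wuG : adj G w u by rewrite adj_sym.
have wuH : ~~ adj H w u by rewrite adj_sym.
have degu := nonadj_small_degree tfG tfH GH uwG uwH.
have degw := nonadj_small_degree tfG tfH GH wuG wuH.
pose N := nbh G u :|: nbh G w; pose Z := ~: N.
have uN : u \in N by rewrite !inE wuG orbT.
have wN : w \in N by rewrite !inE uwG.
have cardN : #|N| < 6 * k by have := cardsUI (nbh G u) (nbh G w); rewrite -/N; lia.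
have degN x : x \in N -> #|nbh G x| < 4 * k.
  rewrite !inE => /orP[ux|wx].
    exact: nonadj_nbr_small_degree tfG tfH GH uwG uwH ux.
  exact: nonadj_nbr_small_degree tfG tfH GH wuG wuH wx.
(* [T] is the boundary of [N]: the vertices outside [N] with a neighbour in [N]. *)
pose T := \bigcup_(x in N) (nbh G x :&: Z).
have cardT : #|T| <= 24 * k ^ 2.
  have : #|T| <= \sum_(x in N) 4 * k.
    apply: leq_trans (_ : \sum_(x in N) #|nbh G x :&: Z| <= _).
      exact: card_bigcup_leq.
    apply: leq_sum => x xN; apply: leq_trans (ltnW (degN x xN)).
    exact/subset_leq_card/subsetIl.
  by rewrite sum_nat_const; nia.
pose comp t := [set z | connect (induced_adj G Z) t z].
(* Follow a path from [z] to [u], which lies in [N]: the last vertex before the path first enters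
   [N] belongs to [T]. *)
have reach z : z \in Z -> exists2 t, t \in T & z \in comp t.
  case/induced_connectedP: cG => _ /(_ z u (in_setT _) (in_setT _)).
  case/connectP => p; elim: p z => [|y p IHp] z /=.
    by move=> _ <- /setCP.
  case/andP=> /and3P[_ _ zy] yp lastp zZ; have [yZ|] := boolP (y \in Z).
    have [t tT ty] := IHp y yp lastp yZ; exists t => //.
    rewrite !inE in ty *; apply: connect_trans ty (connect1 _).
    by rewrite induced_adjE yZ zZ adj_sym.
  rewrite in_setC negbK => yN; exists z; last by rewrite inE.
  by apply/bigcupP; exists y; rewrite // in_setI zZ inE adj_sym zy.
(* First case: some component [C] of the complement of [N] that meets [T] has at least [k]
   vertices. *)
have [/existsP[t /andP[tT bigt]]|] := boolP [exists t, (t \in T) && (k <= #|comp t|)].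
  pose C := comp t.
  have [x xN /setIP[xt tZ]] := bigcupP tT; rewrite inE in xt.
  have compZ z : z \in C -> z \in Z.
    rewrite inE => /connectP[p]; elim/last_ind: p => [_ -> //|p y _].
    by rewrite rcons_path last_rcons => /andP[_ /and3P[_ yZ _]] ->.
  have cC : induced_connected G C.
    apply/induced_connectedP; split; first by apply/set0Pn; exists t; rewrite inE.
    (* A path from [t] in [Z] stays in [C], since each of its prefixes ends in [C]. *)
    suff tP z : z \in C -> connect (induced_adj G C) t z.
      move=> a b aC bC; apply: connect_trans (tP b bC).
      by rewrite induced_connect_sym tP.
    rewrite inE => /connectP[p]; elim/last_ind: p z => [z _ -> //|p y IHp z].
    rewrite rcons_path last_rcons => /andP[tp e] ->.
    have lastC : last t p \in C by rewrite inE; apply/connectP; exists p.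
    apply: connect_trans (IHp _ tp erefl) (connect1 _); rewrite induced_adjE lastC.
    case/and3P: (e) => _ _ ->; rewrite andbT inE.
    by rewrite inE in lastC; apply: connect_trans lastC (connect1 e).
  have cxC : induced_connected G (x |: C).
    by apply: (induced_connectedU1 (u := t)); rewrite // ?inE // adj_sym.
  have kxC : k <= #|x |: C|.
    by apply: leq_trans bigt _; apply/subset_leq_card/subsetUr.
  have notN z : z \in C -> (~~ adj G u z) && (~~ adj G w z).
    by move/compZ; rewrite !inE negb_or.
  have uC : u \notin C by apply/negP => /compZ; rewrite in_setC uN.
  have wC : w \notin C by apply/negP => /compZ; rewrite in_setC wN.
  have Cx : x \notin C by apply/negP => /compZ; rewrite in_setC xN.
  have tC : t \in C by rewrite inE.
  have xu : x != u by apply: contraTneq xt => ->; case/andP: (notN t tC).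
  have xw : x != w by apply: contraTneq xt => ->; case/andP: (notN t tC).
  (* The set [x |: C] sees [a] through [x] but not [b]: [C] avoids the neighbours of [b], and an
     edge from [x] to [b] would close a triangle with [a]. *)
  have sepL a b : adj G a b -> ~~ adj H a b -> x != b -> adj G a x ->
      b \notin C -> (forall z, z \in C -> ~~ adj G b z) -> False.
    move=> ab abH xb ax bC bN; case/negP: abH.
    apply: (separating_set_adj GH kxC cxC ab).
    - by rewrite in_setU1 negb_or eq_sym xb.
    - by exists x; rewrite ?setU11 // adj_sym.
    move=> z /setU1P[->|/bN]; last by rewrite adj_sym.
    by apply/negP => xb'; apply: triangle_freeP tfG ax xb' ab.
  have : (adj G u x) || (adj G w x) by move: xN; rewrite !inE.
  case/orP => [ux|wx].
    by apply: (sepL u w) => // z /notN/andP[].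
  by apply: (sepL w u) => // z /notN/andP[].
rewrite negb_exists => /forallP small.
(* Second case: components with fewer than [k] vertices, one for each vertex of [T], cover [Z],
   which makes the graph too small. *)
have cardZ : #|Z| <= #|T| * k.
  rewrite -sum_nat_const.
  apply: leq_trans (_ : #|\bigcup_(t in T) comp t| <= _).
    apply/subset_leq_card/subsetP => z /reach[t tT zt].
    by apply/bigcupP; exists t.
  apply: leq_trans (_ : \sum_(t in T) #|comp t| <= _).
    exact: card_bigcup_leq.
  apply: leq_sum => t tT; have := small t; rewrite tT /= -ltnNge.
  exact: ltnW.
have := cardsC N; rewrite -/Z; move: large; rewrite /large_order.
have : k <= k ^ 3 by rewrite -{1}(expn1 k) leq_exp2l.
have : #|T| * k <= 24 * k ^ 3 by rewrite expnSr mulnA leq_mul2r cardT orbT.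
lia.
Qed.

Theorem connected_ksets_unique G H : large_order <= #|V| -> connected_graph H ->
  triangle_free G -> triangle_free H ->
  (forall K, #|K| = k -> induced_connected G K = induced_connected H K) ->
  G = H.
Proof.
move=> large cH tfG tfH GH.
have GH' : same_connected G H.
  move=> A kA; apply/idP/idP; apply: (connected_ksets_transfer (k := k)) => // K _.
    by move=> cardK; rewrite GH.
  by move=> cardK; rewrite GH.
have kV : k <= #|[set: V]|.
  rewrite cardsT; apply: leq_trans large; rewrite /large_order.
  by rewrite expnSr mulnA leq_pmull // muln_gt0 expn_gt0; lia.
(* The full vertex set has at least [k] elements, so connectedness passes from [H] to [G]. *)
have cG : connected_graph G by rewrite /connected_graph GH'.
apply: sgraph_ext => u v; apply/idP/idP; apply: same_connected_adj => //.
exact: same_connected_sym.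
Qed.

End Uniqueness.

(** * Graphs of relations and pullbacks along maps *)

Section Pullback.

(** Defined for an arbitrary relation, because the relation of a candidate is known to be symmetric
    and irreflexive only once it has passed the check. *)
Definition rel_edges (V : finType) (a : rel V) : {set {set V}} :=
  [set e : {set V} | [exists u, exists v, [&& u != v, a u v & e == [set u; v]]]].

Lemma rel_edges_card (V : finType) (a : rel V) :
  [forall e in rel_edges a, #|e| == 2].
Proof.
apply/forall_inP => e; rewrite inE => /existsP[u /existsP[v /and3P[uv _ /eqP->]]].
by rewrite cards2 uv.
Qed.

Definition rel_graph (V : finType) (a : rel V) : sgraph V :=
  SGraph (rel_edges_card a).

Lemma adj_rel_graph (V : finType) (a : rel V) :
  symmetric a -> irreflexive a -> adj (rel_graph a) =2 a.
Proof.
move=> sa ia u v; rewrite /adj /= inE; apply/idP/idP => [|auv]; last first.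
  apply/existsP; exists u; apply/existsP; exists v; rewrite auv eqxx !andbT.
  by apply: contraTneq auv => ->; rewrite ia.
case/existsP => x /existsP[y /and3P[+ + /eqP e]].
have := set21 x y; have := set22 x y; rewrite -e => /set2P ys /set2P xs.
by case: xs => ->; case: ys => ->; rewrite ?eqxx // sa.
Qed.

Variables (W V : finType) (h : W -> V).
Implicit Types G : sgraph V.

(** For injective [h] this is the subgraph induced by the image of [h], relabelled by [W]. *)
Definition pullback G : sgraph W := rel_graph (relpre h (adj G)).

Lemma adj_pullback G i j : adj (pullback G) i j = adj G (h i) (h j).
Proof.
rewrite /pullback adj_rel_graph //= => [x y|x] /=; first by rewrite adj_sym.
by rewrite adj_irrefl.
Qed.

Lemma triangle_free_pullback G : triangle_free G -> triangle_free (pullback G).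
Proof.
move=> tf; apply/forallP => u; apply/forallP => v; apply/forallP => w.
apply/negP; rewrite !adj_pullback => /and3P[]; exact: triangle_freeP tf.
Qed.

Lemma induced_connected_pullback G (K : {set W}) : injective h ->
  induced_connected (pullback G) K = induced_connected G (h @: K).
Proof.
move=> hI; have connE i j : i \in K ->
    connect (induced_adj G (h @: K)) (h i) (h j) =
    connect (induced_adj (pullback G) K) i j.
  move=> iK; apply/connectP/connectP => [][p].
    elim: p i iK => [|v p IHp] i iK /=.
      by move=> _ /hI ->; exists [::].
    case/andP => /and3P[_ /imsetP[l lK ->] il] lp lastp.
    have [q lq lastq] := IHp l lK lp lastp.
    by exists (l :: q) => //=; rewrite lq induced_adjE iK lK adj_pullback il.
  elim: p i iK => [|l p IHp] i iK /=.
    by move=> _ ->; exists [::].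
  case/andP => /and3P[_ lK il] lp lastp; rewrite adj_pullback in il.
  have [q lq lastq] := IHp l lK lp lastp.
  by exists (h l :: q) => //=; rewrite lq induced_adjE !imset_f ?il.
have K0 : (h @: K == set0) = (K == set0).
  by rewrite -!cards_eq0 card_imset.
apply/induced_connectedP/induced_connectedP => [][Kn cK]; split.
- by rewrite K0.
- by move=> _ _ /imsetP[i iK ->] /imsetP[j jK ->]; rewrite connE ?cK.
- by rewrite -K0.
by move=> i j iK jK; rewrite -connE ?cK ?imset_f.
Qed.

End Pullback.

Lemma induced_connected_sub (V : finType) (G H : sgraph V) (A : {set V}) :
  (forall u v, adj G u v -> adj H u v) ->
  induced_connected G A -> induced_connected H A.
Proof.
move=> GH /induced_connectedP[A0 cA]; apply/induced_connectedP; split=> // u v uA vA.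
apply: connect_sub (cA u v uA vA) => x y /and3P[xA yA /GH xy].
by apply: connect1; rewrite induced_adjE xA yA.
Qed.

(** * Evaluating first-order formulas on the machine *)

Section Machine.
Variable inp : seq nat.
Local Notation bnd j := (nth 0 inp j).

(** A total correctness triple with a bound on the running time. *)
Definition hoare (P : state -> Prop) c T (Q : state -> Prop) :=
  forall s, P s -> exists t s', [/\ exec inp c s t s', t <= T & Q s'].

Lemma hoare_weaken (P P' Q Q' : state -> Prop) c T T' :
  hoare P' c T' Q' -> (forall s, P s -> P' s) -> T' <= T ->
  (forall s, Q' s -> Q s) -> hoare P c T Q.
Proof.
move=> h PP' TT' Q'Q s /PP'/h[t [s' [e tT' /Q'Q q]]].
by exists t, s'; split=> //; apply: leq_trans TT'.
Qed.

Lemma hoare_assign (P Q : state -> Prop) x e :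
  (forall s, P s -> Q (set_var s x (eval inp s e))) ->
  hoare P (CAssign x e) (cost e).+1 Q.
Proof.
by move=> h s /h q; exists (cost e).+1, (set_var s x (eval inp s e)); split=> //; constructor.
Qed.

Lemma hoare_store (P Q : state -> Prop) a e1 e2 :
  (forall s, P s -> Q (set_array s a (eval inp s e1) (eval inp s e2))) ->
  hoare P (CStore a e1 e2) (cost e1 + cost e2).+1 Q.
Proof.
by move=> h s /h q; do 2!eexists; split; [constructor| |exact: q].
Qed.

Lemma hoare_write (P Q : state -> Prop) e :
  (forall s, P s -> Q (write s (eval inp s e))) ->
  hoare P (CWrite e) (cost e).+1 Q.
Proof.
by move=> h s /h q; do 2!eexists; split; [constructor| |exact: q].
Qed.

Lemma hoare_skip (P : state -> Prop) : hoare P CSkip 1 P.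
Proof. by move=> s Ps; do 2!eexists; split; [constructor| |exact: Ps]. Qed.

Lemma hoare_seq (Q P R : state -> Prop) c1 c2 T1 T2 :
  hoare P c1 T1 Q -> hoare Q c2 T2 R -> hoare P (CSeq c1 c2) (T1 + T2) R.
Proof.
move=> h1 h2 s /h1[t1 [s1 [e1 le1 /h2[t2 [s2 [e2 le2 r]]]]]].
by exists (t1 + t2), s2; split=> //; [apply: ExecSeq e1 e2|apply: leq_add].
Qed.

Lemma hoare_if (P Q : state -> Prop) e c1 c2 T :
  hoare (fun s => P s /\ eval inp s e != 0) c1 T Q ->
  hoare (fun s => P s /\ eval inp s e = 0) c2 T Q ->
  hoare P (CIf e c1 c2) (cost e + T).+1 Q.
Proof.
move=> h1 h2 s Ps; have [e0|e0] := eqVneq (eval inp s e) 0.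
  have [t [s' [ex le q]]] := h2 s (conj Ps e0).
  by exists (cost e + t).+1, s'; split=> //; [apply: ExecIfFalse|rewrite ltnS leq_add2l].
have [t [s' [ex le q]]] := h1 s (conj Ps e0).
by exists (cost e + t).+1, s'; split=> //; [apply: ExecIfTrue|rewrite ltnS leq_add2l].
Qed.

Definition cfor x j c :=
  CSeq (CAssign x (EConst 0))
    (CWhile (ESub (EInput (EConst j)) (EVar x))
       (CSeq c (CAssign x (EAdd (EVar x) (EConst 1))))).

(** Each iteration adds 4 for the test, 4 for the increment and 1 for the loop step; the initial
    assignment costs 2 and the final test 5. *)
Definition for_time N T := N * (T + 9) + 7.

(** The invariant is indexed by the number of completed iterations and must not depend on the
    counter, which the loop overwrites; the value of the counter is carried separately. *)
Lemma hoare_for (I : nat -> state -> Prop) x j c T :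
  (forall v s w, I v s -> I v (set_var s x w)) ->
  (forall v, v < bnd j -> hoare (fun s => I v s /\ vars s x = v) c T
                                (fun s => I v.+1 s /\ vars s x = v)) ->
  hoare (I 0) (cfor x j c) (for_time (bnd j) T) (I (bnd j)).
Proof.
move=> Istable body.
suff loop r v : v + r = bnd j -> hoare (fun s => I v s /\ vars s x = v)
    (CWhile (ESub (EInput (EConst j)) (EVar x))
       (CSeq c (CAssign x (EAdd (EVar x) (EConst 1)))))
    (r * (T + 9) + 5) (I (bnd j)).
  have init : hoare (I 0) (CAssign x (EConst 0)) 2
                    (fun s => I 0 s /\ vars s x = 0).
    by apply: hoare_assign => s Is; split; [exact: Istable|rewrite /= eqxx].
  apply: hoare_weaken (hoare_seq init (loop (bnd j) 0 erefl)) _ _ _ => //.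
  by rewrite /for_time; lia.
elim: r v => [|r IHr] v Ev s [Is xv].
  exists 5, s; split; rewrite ?mul0n //; last by rewrite -Ev addn0.
  apply: (@ExecWhileDone inp (ESub (EInput (EConst j)) (EVar x))) => /=.
  by rewrite xv -Ev; lia.
have [|t1 [s1 [e1 le1 [I1 x1]]]] := body v _ s (conj Is xv); first by lia.
pose s2 := set_var s1 x v.+1.
have [||t2 [s3 [e3 le3 I3]]] := IHr v.+1 _ s2.
- by lia.
- by split; [apply: Istable|rewrite /= eqxx].
exists (4 + (t1 + 4) + t2).+1, s3; split=> //; last by rewrite mulSn; lia.
apply: (@ExecWhileStep inp (ESub (EInput (EConst j)) (EVar x)) _ _ s2) e3.
  by rewrite /= xv; lia.
apply: ExecSeq e1 _; rewrite /s2 -x1 -[(vars s1 x).+1]addn1.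
exact: (@ExecAssign inp s1 x (EAdd (EVar x) (EConst 1))).
Qed.

(* [AIn x z c q] compares x with the input entry c + q * z, and [AMark] reads
   array 0; array 1 is the stack on which formulas are evaluated. *)
Inductive atom : Type :=
  | AEq of nat & nat
  | AEqC of nat & nat
  | AIn of nat & nat & nat & nat
  | AMark of nat
  | AGtC of nat.

(** With truncated subtraction the sum is the distance of the two values, so the result is 1 on
    equality and 0 otherwise. *)
Definition eqe e1 e2 := ESub (EConst 1) (EAdd (ESub e1 e2) (ESub e2 e1)).

Definition atom_expr a :=
  match a with
  | AEq x y => eqe (EVar x) (EVar y)
  | AEqC x c => eqe (EVar x) (EConst c)
  | AIn x z c q => eqe (EVar x) (EInput (iter q (EAdd (EVar z)) (EConst c)))
  | AMark x => EGet 0 (EVar x)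
  | AGtC c => ESub (EInput (EConst 0)) (EConst c)
  end.

Definition atom_sem s a : bool :=
  match a with
  | AEq x y => vars s x == vars s y
  | AEqC x c => vars s x == c
  | AIn x z c q => vars s x == bnd (c + q * vars s z)
  | AMark x => arrays s 0 (vars s x) != 0
  | AGtC c => c < bnd 0
  end.

Lemma atom_exprP s a : (eval inp s (atom_expr a) != 0) = atom_sem s a.
Proof.
case: a => [x y|x c|x z c q|x|c] //=; try by lia.
have -> : eval inp s (iter q (EAdd (EVar z)) (EConst c)) = c + q * vars s z.
  by elim: q => [|q IHq] /=; lia.
by lia.
Qed.

(** The flag of a quantifier selects the input entry that bounds its range: entry 0 is the number of
    vertices, entry 1 the size of the first family. *)
Inductive formula : Type :=
  | FA of atom
  | FNot of formula
  | FAnd of formula & formula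
  | FEx of nat & bool & formula.

Fixpoint sem s f : bool :=
  match f with
  | FA a => atom_sem s a
  | FNot g => ~~ sem s g
  | FAnd g h => sem s g && sem s h
  | FEx x j g => has (fun v => sem (set_var s x v) g) (iota 0 (bnd j))
  end.

Lemma sem_ext s s' f : vars s =1 vars s' -> arrays s 0 =1 arrays s' 0 ->
  sem s f = sem s' f.
Proof.
elim: f s s' => [a|g IHg|g IHg h IHh|x j g IHg] s s' vE aE /=.
- by case: a => [x y|x c|x z c q|x|c] //=; rewrite !vE ?aE.
- by rewrite (IHg _ s').
- by rewrite (IHg _ s') // (IHh _ s').
by apply: eq_has => v; apply: IHg => //= y; case: eqP.
Qed.

Definition stk d := EGet 1 (EConst d).
Definition push d e := CStore 1 (EConst d) e.
Definition note e := ESub (EConst 1) e.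

(** The truth value, nonzero for true, is left in stack cell [d]; cells below [d] are preserved.
    Conjunction goes through De Morgan. A quantifier saves the bound variable in cell [d.+1] and
    sums the values of its body in cell [d]. *)
Fixpoint compile d f : cmd :=
  match f with
  | FA a => push d (atom_expr a)
  | FNot g => CSeq (compile d g) (push d (note (stk d)))
  | FAnd g h =>
      CSeq (compile d g) (CSeq (compile d.+1 h)
        (push d (note (EAdd (note (stk d)) (note (stk d.+1))))))
  | FEx x j g =>
      CSeq (push d.+1 (EVar x)) (CSeq (push d (EConst 0))
        (CSeq (cfor x j (CSeq (compile d.+2 g)
                              (push d (EAdd (stk d) (stk d.+2)))))
              (CAssign x (stk d.+1))))
  end.

Fixpoint form_time (b : nat -> nat) f : nat :=
  match f with
  | FA a => cost (atom_expr a) + 2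
  | FNot g => form_time b g + 6
  | FAnd g h => form_time b g + form_time b h + 13
  | FEx x j g => for_time (b j) (form_time b g + 7) + 9
  end.

Definition same d s s' :=
  [/\ vars s' =1 vars s,
      forall a i, (a != 1) || (i < d) -> arrays s' a i = arrays s a i
    & output s' = output s].

Lemma sem_same d s s' f : same d s s' -> sem s' f = sem s f.
Proof. by case=> vE aE _; apply: sem_ext => // i; apply: aE. Qed.

Lemma same_trans d d' s1 s2 s3 : d <= d' ->
  same d s1 s2 -> same d' s2 s3 -> same d s1 s3.
Proof.
move=> dd' [v a o] [v' a' o']; split=> [x|b i bi|]; last by rewrite o'.
  by rewrite v' v.
by rewrite a' ?a //; lia.
Qed.

Lemma same_push d i v s : d <= i -> same d s (set_array s 1 i v).
Proof.
by move=> di; split=> // a j ad /=; case: andP => // -[/eqP a1 /eqP ji]; lia.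
Qed.

Lemma compileP f d s : exists t s', [/\ exec inp (compile d f) s t s',
  t <= form_time (nth 0 inp) f, same d s s' & (arrays s' 1 d != 0) = sem s f].
Proof.
elim: f d s => [a|g IHg|g IHg h IHh|x j g IHg] d s /=.
- do 2!eexists; split; first exact: ExecStore.
  + by rewrite /=; lia.
  + exact: same_push.
  + by rewrite /= !eqxx /= atom_exprP.
- have [t [s' [ex le sm r]]] := IHg d s.
  do 2!eexists; split; first exact: ExecSeq ex (ExecStore _ _ _ _ _).
  + by rewrite /=; lia.
  + by apply: (same_trans (leqnn d) sm); apply: same_push.
  + by rewrite /= !eqxx /= -r; lia.
- have [t [s' [ex le sm r]]] := IHg d s.
  have [t' [s'' [ex' le' sm' r']]] := IHh d.+1 s'.
  do 2!eexists; split.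
  + exact: ExecSeq ex (ExecSeq ex' (ExecStore _ _ _ _ _)).
  + by rewrite /=; lia.
  + apply: (same_trans (leqnn d) (same_trans (leqnSn d) sm sm')).
    exact: same_push.
  + rewrite /= !eqxx /= -r -(sem_same _ sm) -r'.
    case: sm' => _ aE _; rewrite (aE 1 d) /=; last by lia.
    by lia.
(* After [v] iterations the accumulator in cell [d] is nonzero iff some value below [v] satisfies
   the body, and cell [d.+1] still holds the original value of [x]. *)
pose I v s' := [/\ forall y, y != x -> vars s' y = vars s y,
    forall a i, (a != 1) || (i < d) -> arrays s' a i = arrays s a i,
    output s' = output s, arrays s' 1 d.+1 = vars s x
  & (arrays s' 1 d != 0) = has (fun w => sem (set_var s x w) g) (iota 0 v)].
pose s1 := set_array (set_array s 1 d.+1 (vars s x)) 1 d 0.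
have I0 : I 0 s1.
  split=> // [a i ai||].
  - rewrite /=; case: andP => [[/eqP ? /eqP ?]|_]; first by lia.
    by case: andP => // -[/eqP ? /eqP ?]; lia.
  - by rewrite /= !eqxx /=; case: eqP => //; lia.
  - by rewrite /= !eqxx.
have loop : hoare (I 0)
    (cfor x j (CSeq (compile d.+2 g) (push d (EAdd (stk d) (stk d.+2)))))
    (for_time (bnd j) (form_time (nth 0 inp) g + 7)) (I (bnd j)).
  apply: hoare_for.
  - move=> v s' w [vE aE oE xE rE]; split=> // y yx.
    by rewrite /= (negbTE yx) vE.
  - move=> v vj s' [[vE aE oE xE rE] xv].
    have [t [s'' [ex le [v' a' o'] r]]] := IHg d.+2 s'.
    do 2!eexists; split; first exact: ExecSeq ex (ExecStore _ _ _ _ _).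
      by rewrite /=; lia.
    split; last by rewrite /= v'.
    split=> [y yx|a i ai|||].
    + by rewrite /= v' vE.
    + rewrite /=; case: andP => [[/eqP ? /eqP ?]|_]; first by lia.
      by rewrite a' ?aE //; lia.
    + by rewrite /= o'.
    + by rewrite /= gtn_eqF // a' ?xE //; lia.
    + rewrite -[v.+1]addn1 iotaD has_cat /= !eqxx /= orbF -rE a'; last by lia.
      have -> : sem (set_var s x v) g = sem s' g.
        apply: sem_ext => [y|i] /=; last by rewrite aE.
        by case: eqVneq => [->|yx]; rewrite ?xv // vE.
      by rewrite -r; lia.
have [t [s2 [ex le [v2 a2 o2 x2 r2]]]] := loop s1 I0.
have st1 := ExecStore inp s 1 (EConst d.+1) (EVar x).
have st2 := ExecStore inp (set_array s 1 d.+1 (vars s x)) 1 (EConst d) (EConst 0).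
have st3 := ExecAssign inp s2 x (stk d.+1).
do 2!eexists; split; first exact: ExecSeq st1 (ExecSeq st2 (ExecSeq ex st3)).
- by rewrite /=; lia.
- split=> //= y; case: eqVneq => [->|]; [exact: x2|exact: v2].
- by rewrite /= r2.
Qed.

Lemma hoare_compile d f (P : state -> Prop) :
  hoare P (compile d f) (form_time (nth 0 inp) f)
    (fun s' => exists s, [/\ P s, same d s s' & (arrays s' 1 d != 0) = sem s f]).
Proof.
move=> s Ps; have [t [s' [ex le sm r]]] := compileP f d s.
by exists t, s'; split=> //; exists s.
Qed.

End Machine.

(* Variable 0 indexes the members of the input family, odd variables are used by
   the loops of [process] and by the checks, even ones by [large_form]. *)
Definition ov i := i.*2.+1.
Definition ev i := i.*2.+2.

(** * Processing one candidate: reachability, check and output *)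

Definition mark_body (phi : nat -> nat -> formula) :=
  CSeq (compile 0 (FAnd (FA (AMark (ov 1))) (phi (ov 1) (ov 2))))
       (CIf (stk 0) (CStore 0 (EVar (ov 2)) (EConst 1)) CSkip).

(** Reachability from vertex 0 in the style of Bellman and Ford: each of the rounds counted by
    [ov 0] tries all pairs, and after [r] rounds every vertex at distance at most [r] is marked. *)
Definition mark_cmd phi :=
  CSeq (cfor (ov 0) 0 (CStore 0 (EVar (ov 0)) (EConst 0)))
    (CSeq (CStore 0 (EConst 0) (EConst 1))
       (cfor (ov 0) 0 (cfor (ov 1) 0 (cfor (ov 2) 0 (mark_body phi))))).

(** The double [note] turns an arbitrary nonzero truth value into the matrix entry 1. *)
Definition write_body (phi : nat -> nat -> formula) :=
  CSeq (compile 0 (phi (ov 0) (ov 1))) (CWrite (note (note (stk 0)))).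

Definition write_cmd phi := cfor (ov 0) 0 (cfor (ov 1) 0 (write_body phi)).

Definition process phi chk :=
  CSeq (mark_cmd phi)
    (CSeq (compile 0 chk) (CIf (stk 0) (write_cmd phi) CSkip)).

Definition mark_time b (phi : nat -> nat -> formula) :=
  for_time (b 0) (for_time (b 0) (for_time (b 0)
    (form_time b (FAnd (FA (AMark (ov 1))) (phi (ov 1) (ov 2))) + 6))).

Definition write_time b (phi : nat -> nat -> formula) :=
  for_time (b 0) (for_time (b 0) (form_time b (phi (ov 0) (ov 1)) + 7)).

Definition process_time b phi chk :=
  for_time (b 0) 3 + 3 + mark_time b phi +
  (form_time b chk + (write_time b phi + 4)).

Section Process.
Variables (inp : seq nat) (phi : nat -> nat -> formula) (a : rel nat).
Local Notation n := (nth 0 inp 0).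

Hypothesis phiP : forall s x y, odd x -> odd y -> vars s x < n -> vars s y < n ->
  sem inp s (phi x y) = a (vars s x) (vars s y).

Definition step : rel nat := [rel p q | [&& p < n, q < n & a p q]].

Definition marked s v := arrays s 0 v != 0.

Definition marks_sound s := forall v, v < n -> marked s v ->
  exists2 p, path step 0 p & last 0 p = v.

Definition marks_complete r s :=
  forall p, path step 0 p -> size p <= r -> marked s (last 0 p).

Definition frame out r s := output s = out /\ vars s (ov 0) = r.

(** Invariant of one round: [m] stands for the marks present when the round starts, and the sources
    below [u] have been treated. *)
Definition pass_inv out r (m : pred nat) u s := [/\ frame out r s, marks_sound s,
  forall v, m v -> marked s v
  & forall p q, p < u -> m p -> step p q -> marked s q].

Lemma mark_bodyP out r m u v : u < n -> v < n ->
  hoare inp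
    (fun s => (pass_inv out r m u s /\ vars s (ov 1) = u /\
               forall q, q < v -> m u -> step u q -> marked s q)
              /\ vars s (ov 2) = v)
    (mark_body phi)
    (form_time (nth 0 inp) (FAnd (FA (AMark (ov 1))) (phi (ov 1) (ov 2))) + 6)
    (fun s => (pass_inv out r m u s /\ vars s (ov 1) = u /\
               forall q, q < v.+1 -> m u -> step u q -> marked s q)
              /\ vars s (ov 2) = v).
Proof.
move=> un vn; rewrite /mark_body; apply: hoare_seq (@hoare_compile inp _ _ _) _.
set Q := (X in hoare _ _ _ _ X).
(* Both branches of the conditional reduce to one claim about the state after the possible new
   mark. *)
suff post s s' : same 0 s s' ->
    (pass_inv out r m u s /\ vars s (ov 1) = u /\
      forall q, q < v -> m u -> step u q -> marked s q) /\ vars s (ov 2) = v ->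
    (arrays s' 1 0 != 0) = marked s u && a u v ->
    Q (if arrays s' 1 0 != 0 then set_array s' 0 v 1 else s').
  apply: (@hoare_weaken _ _ _ _ _ _ _ (cost (stk 0) + 3).+1
    (hoare_if (T := 3) (Q := Q) (P := fun s' => vars s' (ov 2) = v /\
        Q (if arrays s' 1 0 != 0 then set_array s' 0 v 1 else s')) _ _)) => //.
  - by apply: hoare_store => s [[sv q] /= nz]; move: q; rewrite nz sv.
  - apply: (hoare_weaken (@hoare_skip inp Q)) => // s [[sv q] /= z].
    by move: q; rewrite z.
  - move=> s' [s [Ps sm rE]]; split; first by case: sm (Ps) => -> _ _ [].
    apply: (post s s' sm Ps); rewrite rE /=.
    by case: Ps => -[_ [u1 _]] v1; rewrite phiP ?u1 ?v1.
move=> sm [[[[fo fr] snd sub old] [u1 cur]] v1] rE; case: sm => vE aE oE.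
have mE p : marked s' p = marked s p by rewrite /marked aE.
case: ifP => [nz|z]; last first.
  rewrite rE in z; split; last by rewrite vE.
  split; last split.
  - split=> [|w wn|w mw|p q pu mp pq].
    + by rewrite /frame oE vE.
    + by rewrite mE; apply: snd.
    + by rewrite mE sub.
    + by rewrite mE (old p).
  - by rewrite vE.
  - move=> q; rewrite ltnS leq_eqVlt mE => /orP[/eqP->|qv] mu uq; last exact: cur.
    by case/and3P: uq => _ _ auv; move: z; rewrite sub // auv.
have [mu auv] : marked s u /\ a u v by move: nz; rewrite rE => /andP.
have mE' p : marked (set_array s' 0 v 1) p = (p == v) || marked s p.
  by rewrite -mE /marked /=; case: (p == v).
split; last by rewrite /= vE.
split; last split.
- split=> [|w wn|w mw|p q pu mp pq].
  + by rewrite /frame /= oE vE.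
  + rewrite mE' => /orP[/eqP->|]; last exact: snd.
    have [p sp lastp] := snd u un mu; exists (rcons p v); last by rewrite last_rcons.
    by rewrite rcons_path sp lastp /step /= un vn.
  + by rewrite mE' sub ?orbT.
  + by rewrite mE' (old p) ?orbT.
- by rewrite /= vE.
move=> q; rewrite ltnS leq_eqVlt mE' => /orP[->//|qv] mu' uq.
by rewrite cur ?orbT.
Qed.

Lemma mark_passP out r (m : pred nat) :
  hoare inp (fun s => [/\ frame out r s, marks_sound s &
                          forall v, m v -> marked s v])
    (cfor (ov 1) 0 (cfor (ov 2) 0 (mark_body phi)))
    (for_time n (for_time n
      (form_time (nth 0 inp) (FAnd (FA (AMark (ov 1))) (phi (ov 1) (ov 2))) + 6)))
    (pass_inv out r m n).
Proof.
apply: hoare_weaken (hoare_for (I := pass_inv out r m) _ _) _ (leqnn _) _; last by [].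
- by move=> v s w.
- move=> u un; pose I v s := pass_inv out r m u s /\ vars s (ov 1) = u /\
    forall q, q < v -> m u -> step u q -> marked s q.
  apply: hoare_weaken (hoare_for (I := I) (c := mark_body phi) _ _) _ (leqnn _) _.
  + by move=> v s w [inv [u1 cur]]; split=> //; split.
  + by move=> v vn; apply: mark_bodyP.
  + by move=> s [inv u1]; split=> //; split.
  move=> s [[fr snd sub old] [u1 cur]]; split=> //; split=> // p q.
  rewrite ltnS leq_eqVlt => /orP[/eqP->|pu] mp pq; last exact: old pu mp pq.
  by apply: cur => //; case/and3P: pq.
by move=> s [fr snd sub]; split.
Qed.

Lemma mark_cmdP out :
  hoare inp (fun s => output s = out) (mark_cmd phi)
    (for_time n 3 + 3 + mark_time (nth 0 inp) phi)
    (fun s => [/\ output s = out, marks_sound s & marks_complete n s]).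
Proof.
rewrite -addnA.
apply: (@hoare_seq _ (fun s => output s = out /\ forall v, v < n -> ~~ marked s v)).
  pose I w s := output s = out /\ forall v, v < w -> ~~ marked s v.
  apply: hoare_weaken (hoare_for (I := I) (T := 3) _ _) _ (leqnn _) _ => //.
  move=> w wn; apply: hoare_store => s [[so inv] sw]; split=> //; split=> // v.
  rewrite ltnS leq_eqVlt /marked /= sw; case: eqVneq => //= vw; exact: inv.
apply: (@hoare_seq _ (fun s => [/\ output s = out, marks_sound s &
                                   marks_complete 0 s])).
  apply: hoare_store => s [so inv]; split=> // [v vn|]; last by case.
  rewrite /marked /=; case: (eqVneq v 0) => [-> _|v0] /=; first by exists [::].
  by move=> mv; case/negP: (inv v vn).
apply: (@hoare_for _ (fun r s => [/\ output s = out, marks_sound s &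
                                   marks_complete r s])) => //.
move=> r rn s [[so snd cmp] sr].
have [|t [s' [ex le [[so' sr'] snd' sub' new']]]] :=
  @mark_passP out r (marked s) s; first by split.
exists t, s'; split=> //; split=> //; split=> // p.
(* The last but one vertex of a path of at most [r.+1] steps was already marked before this
   round. *)
elim/last_ind: p => [_ _|p q _]; first exact/sub'/(cmp [::]).
rewrite rcons_path last_rcons size_rcons ltnS => /andP[sp pq] szp.
by apply: (new' _ _ _ (cmp p sp szp) pq); case/and3P: pq.
Qed.

Lemma write_cmdP out :
  hoare inp (fun s => output s = out) (write_cmd phi) (write_time (nth 0 inp) phi)
    (fun s => output s =
       out ++ [seq nat_of_bool (a i j) | i <- iota 0 n, j <- iota 0 n]).
Proof.
pose I u s := output s =
  out ++ [seq nat_of_bool (a i j) | i <- iota 0 u, j <- iota 0 n].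
apply: hoare_weaken (hoare_for (I := I) _ _) _ (leqnn _) _.
- by [].
- move=> u un; pose J v s := output s =
    out ++ [seq nat_of_bool (a i j) | i <- iota 0 u, j <- iota 0 n] ++
    [seq nat_of_bool (a u j) | j <- iota 0 v] /\ vars s (ov 0) = u.
  apply: hoare_weaken (hoare_for (I := J) (c := write_body phi) _ _) _ (leqnn _) _.
  + by [].
  + move=> v vn; rewrite /write_body; apply: hoare_seq (@hoare_compile inp _ _ _) _.
    apply: hoare_write => s' [s [[[so su] sv] [vE aE oE] r]].
    split; last by rewrite /= vE.
    split; last by rewrite /= vE.
    rewrite -[v.+1]addn1 iotaD map_cat /= oE so cats1 !rcons_cat.
    congr (_ ++ (_ ++ rcons _ _)).
    by move: r; rewrite phiP ?su ?sv // => <-; case: (arrays _ _ _) => //= m; lia.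
  + by move=> s [so su]; split=> //; rewrite cats0.
  move=> s [so su]; split=> //.
  by rewrite /I -[u.+1]addn1 iotaD allpairs_cat /= cats0.
- by move=> s so; rewrite /I /= cats0.
- by [].
Qed.

Lemma processP chk out :
  hoare inp (fun s => output s = out) (process phi chk)
    (process_time (nth 0 inp) phi chk)
    (fun s => exists s1, [/\ marks_sound s1, marks_complete n s1 &
       output s = out ++ (if sem inp s1 chk then
         [seq nat_of_bool (a i j) | i <- iota 0 n, j <- iota 0 n] else [::])]).
Proof.
apply: hoare_seq (@mark_cmdP out) _; apply: hoare_seq (@hoare_compile inp _ _ _) _.
move=> s' [s1 [[so snd cmp] [vE aE oE] r]]; rewrite -oE in so.
have := @hoare_if inp (eq s') (fun s => output s = out ++ (if sem inp s1 chk then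
  [seq nat_of_bool (a i j) | i <- iota 0 n, j <- iota 0 n] else [::]))
  (* A common bound for both branches; the extra unit covers [CSkip]. *)
  (stk 0) (write_cmd phi) CSkip (write_time (nth 0 inp) phi).+1.
case/(_ _ _ s' erefl).
- move=> _ [<- /= nz]; rewrite -r nz.
  have [t [s [ex le q]]] := write_cmdP so.
  by exists t, s; split=> //; lia.
- move=> _ [<- /= z]; rewrite -r z /= cats0.
  by exists 1, s'; split=> //; constructor.
move=> t [s [ex le q]]; exists t, s; split=> //; last by exists s1.
by move: le => /=; lia.
Qed.

End Process.

(** * Formulas on an instance *)

Definition ftrue := FA (AEq 0 0).
Definition fands l := foldr FAnd ftrue l.
Definition fors l := FNot (fands [seq FNot f | f <- l]).
Definition fimp f g := FNot (FAnd f (FNot g)).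
Definition fiff f g := FAnd (fimp f g) (fimp g f).
Definition signed (b : bool) f := if b then f else FNot f.
Definition exs xs f := foldr (fun x => FEx x false) f xs.
Definition alls xs f := FNot (exs xs (FNot f)).

Definition distinct xs :=
  fands [seq fands [seq if x == y then ftrue else FNot (FA (AEq x y)) | y <- xs]
        | x <- xs].

Definition set_vars s (xs : seq nat) (g : nat -> nat) : state :=
  State (fun y => if y \in xs then g y else vars s y) (arrays s) (output s).

Section FormulaSemantics.
Variables (inp : seq nat) (s : state).

Lemma sem_and f g : sem inp s (FAnd f g) = sem inp s f && sem inp s g.
Proof. by []. Qed.

Lemma sem_fands l : sem inp s (fands l) = all (sem inp s) l.
Proof. by elim: l => [|f l IHl] /=; rewrite ?eqxx ?IHl. Qed.

Lemma sem_fors l : sem inp s (fors l) = has (sem inp s) l.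
Proof. by rewrite /= sem_fands all_map -has_predC; apply: eq_has => f /=; rewrite negbK. Qed.

Lemma sem_fimp f g : sem inp s (fimp f g) = (sem inp s f ==> sem inp s g).
Proof. by rewrite /= negb_and negbK implybE. Qed.

Lemma sem_fiff f g : sem inp s (fiff f g) = (sem inp s f == sem inp s g).
Proof. by rewrite [LHS]/= !negb_and !negbK; case: (sem _ _ f); case: (sem _ _ g). Qed.

Lemma sem_signed b f : sem inp s (signed b f) = (sem inp s f == b).
Proof. by case: b => /=; rewrite ?eqb_id ?eqbF_neg. Qed.

Lemma sem_distinct xs :
  reflect {in xs &, injective (vars s)} (sem inp s (distinct xs)).
Proof.
rewrite sem_fands all_map; apply: (iffP allP) => [h x y xxs yxs xy|h x xxs].
  have := h x xxs; rewrite /= sem_fands all_map => /allP/(_ y yxs) /=.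
  by case: eqP => // /eqP nxy /=; rewrite xy eqxx.
rewrite /= sem_fands all_map; apply/allP => y yxs /=.
case: eqP => [_|nxy] /=; first by rewrite eqxx.
by apply/eqP => /(h _ _ xxs yxs).
Qed.

End FormulaSemantics.

Lemma sem_exs inp s xs f : sem inp s (exs xs f) <->
  exists2 g, (forall x, x \in xs -> g x < nth 0 inp 0) &
             sem inp (set_vars s xs g) f.
Proof.
elim: xs s => [|x xs IHxs] s /=.
  have E g : sem inp (set_vars s [::] g) f = sem inp s f by exact: sem_ext.
  by split=> [sf|[g _]]; rewrite ?E //; exists id; rewrite ?E.
split=> [/hasP[v]|[g gn sf]].
  rewrite mem_iota /= => vn /IHxs[g gn sf].
  (* If a name is repeated, the inner quantifier determines its value. *)
  exists (fun y => if y \in xs then g y else v) => [y _|].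
    by case: ifP => // /gn.
  rewrite -(@sem_ext _ (set_vars (set_var s x v) xs g)) // => y /=.
  by rewrite inE; case: (y \in xs); rewrite ?orbT ?orbF.
apply/hasP; exists (g x); first by rewrite mem_iota gn ?mem_head.
apply/IHxs; exists g => [y yxs|]; first by rewrite gn // inE yxs orbT.
rewrite -(@sem_ext _ (set_vars s (x :: xs) g)) // => y /=.
by rewrite inE; case: (y \in xs); rewrite ?orbT ?orbF //; case: eqP => // ->.
Qed.

(** Members of the first family have [k] elements each, so member [z] occupies the input entries
    from [2 + k * z] on, after the number of vertices and the size of the family. The formula says
    that all of [xs] lie in one member; for [k] distinct vertices this means that they form that
    member. *)
Definition family_form k xs :=
  FEx 0 true (fands [seq fors [seq FA (AIn x 0 (2 + i) k) | i <- iota 0 k] | x <- xs]).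

Lemma nth_flatten_block (X : eqType) (x0 : X) k (ss : seq (seq X)) r i j :
  all (fun b => size b == k) ss -> j < k -> i < size ss ->
  nth x0 (flatten ss ++ r) (j + k * i) = nth x0 (nth [::] ss i) j.
Proof.
elim: ss i => [|b ss IHss] [|i] //= /andP[/eqP szb szss] jk iss.
  by rewrite muln0 addn0 -catA nth_cat szb jk.
rewrite -catA nth_cat szb ltnNge mulnS addnCA leq_addr /= addKn.
exact: IHss.
Qed.

Lemma ffact_leq_expn n m : n ^_ m <= n ^ m.
Proof.
elim: m n => [|m IHm] n //; rewrite ffactnS expnS leq_mul //.
by apply: leq_trans (IHm _) _; case: m {IHm} => // m; rewrite leq_exp2r // leq_pred.
Qed.

Section Instance.
Variables (V : finType) (k : nat) (S T : {set {set V}}).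
Hypothesis STk : complete_ksets k S T.
Local Notation inp := (encode_instance S T).
Local Notation rk := (@encode_vertex V).

Lemma rk_inj : injective rk.
Proof. by move=> u v /val_inj/enum_rank_inj. Qed.

Lemma rk_lt v : rk v < #|V|.
Proof. exact: ltn_ord. Qed.

Lemma rk_surj p : p < #|V| -> exists v, rk v = p.
Proof.
by move=> pV; exists (enum_val (Ordinal pV)); rewrite /encode_vertex enum_valK.
Qed.

Lemma family_card A : A \in S -> #|A| = k.
Proof.
by move=> AS; case: STk => /setP/(_ A); rewrite !inE AS => /esym/eqP.
Qed.

(** This keeps the quantifier over the members of the family polynomial. *)
Lemma family_size : #|S| <= #|V| ^ k.
Proof.
apply: leq_trans (_ : #|ksets V k| <= _).
  apply/subset_leq_card/subsetP => A AS; rewrite inE; exact/eqP/family_card.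
rewrite card_draws; apply: leq_trans (_ : #|V| ^_ k <= _).
  by rewrite -bin_ffact leq_pmulr ?fact_gt0.
exact: ffact_leq_expn.
Qed.

Lemma family_formP s xs vs : 0 \notin xs -> [seq vars s x | x <- xs] = map rk vs ->
  uniq vs -> size vs = k ->
  sem inp s (family_form k xs) = ([set v in vs] \in S).
Proof.
move=> xs0 xsE vsU vsk.
have memE z : z < #|S| ->
    sem inp (set_var s 0 z)
      (fands [seq fors [seq FA (AIn x 0 (2 + i) k) | i <- iota 0 k] | x <- xs]) =
    ([set v in vs] == nth set0 (enum S) z).
  move=> zS; set A := nth _ _ _.
  have AS : A \in S by rewrite -mem_enum mem_nth // -cardE.
  have szA : size (encode_set A) = k by rewrite size_map -cardE family_card.
  rewrite sem_fands all_map.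
  have -> : all (preim (fun x => fors [seq FA (AIn x 0 (2 + i) k) | i <- iota 0 k])
      (sem inp (set_var s 0 z))) xs = all (mem (encode_set A)) [seq vars s x | x <- xs].
    rewrite all_map; apply: eq_in_all => x xxs /=.
    have x0 : x != 0 by apply: contraNneq xs0 => <-.
    rewrite -/(fors _) -[LHS]/(sem inp _ (fors _)) sem_fors has_map.
    rewrite -[_ \in _]/(vars s x \in encode_set A).
    have nthE i : i < k -> nth 0 inp (2 + i + k * z) = nth 0 (encode_set A) i.
      move=> ik; rewrite -addnA /= nth_flatten_block //.
      - by rewrite (nth_map set0) -?cardE.
      - apply/allP => b /mapP[B]; rewrite mem_enum => /family_card BS ->.
        by rewrite size_map -cardE BS.
      - by rewrite size_map -cardE.
    have semE i : sem inp (set_var s 0 z) (FA (AIn x 0 (2 + i) k)) =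
        (vars s x == nth 0 inp (2 + i + k * z)).
      by have <- : vars (set_var s 0 z) x = vars s x by rewrite /= (negbTE x0).
    apply/hasP/nthP => [][i]; rewrite ?mem_iota ?szA => ik.
      by rewrite inE semE nthE // => /eqP ->; exists i.
    by move=> xi; exists i; rewrite ?mem_iota // inE semE nthE // xi.
  rewrite xsE all_map eqEcard family_card // cardsE (card_uniqP vsU) vsk leqnn andbT.
  apply/allP/subsetP => h v.
    rewrite inE => /h /mapP[w]; rewrite mem_enum => wA /rk_inj ->; exact: wA.
  by move=> vvs; apply: map_f; rewrite mem_enum h ?inE.
rewrite [LHS]/=; apply/hasP/idP => [[z]|vsS].
  rewrite mem_iota => zS; rewrite memE // => /eqP ->.
  by rewrite -mem_enum mem_nth // -cardE.
have zS : index [set v in vs] (enum S) < #|S| by rewrite cardE index_mem mem_enum.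
exists (index [set v in vs] (enum S)); first by rewrite mem_iota.
by rewrite memE // nth_index // mem_enum.
Qed.
End Instance.

(** * Formulas for the check and for the candidates *)

Definition edge_list m (K : sgraph 'I_m) : seq ('I_m * 'I_m) :=
  [seq p <- enum {: 'I_m * 'I_m} | adj K p.1 p.2].

Definition names (nm : nat -> nat) m := [seq nm (val i) | i <- enum [set: 'I_m]].

(** A graph on [k] vertices is connected iff it contains the edges of some connected graph on
    ['I_k]; there are constantly many of these. *)
Definition connected_form (k : nat) (phi : nat -> nat -> formula) :=
  fors [seq fands [seq phi (ov p.1) (ov p.2) | p : 'I_k * 'I_k <- edge_list K]
       | K : sgraph 'I_k <- enum {: sgraph 'I_k} & connected_graph K].

Definition simple_form (phi : nat -> nat -> formula) :=
  alls [:: ov 0; ov 1] (fimp (phi (ov 0) (ov 1))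
    (FAnd (FNot (FA (AEq (ov 0) (ov 1)))) (phi (ov 1) (ov 0)))).

Definition triangle_free_form (phi : nat -> nat -> formula) :=
  alls [:: ov 0; ov 1; ov 2] (FNot
    (FAnd (phi (ov 0) (ov 1)) (FAnd (phi (ov 1) (ov 2)) (phi (ov 0) (ov 2))))).

(** Connectedness of the whole graph is not a first-order condition on adjacency, so it is read off
    the marks computed beforehand. *)
Definition all_marked_form := alls [:: ov 0] (FA (AMark (ov 0))).

Definition consistent_form k phi :=
  alls (names ov k) (fimp (distinct (names ov k))
    (fiff (family_form k (names ov k)) (connected_form k phi))).

(** The conjunct [AGtC 0] rejects the empty vertex set, on which the universal conditions hold
    vacuously although the graph does not count as connected. *)
Definition check_form k gd phi :=
  FAnd gd (FAnd (FA (AGtC 0)) (FAnd (simple_form phi)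
    (FAnd all_marked_form (FAnd (triangle_free_form phi) (consistent_form k phi))))).

(** The variables [ev i] name the vertices carrying [H]: some edge of [H] is placed on [x] and [y],
    and the family prescribes on each [k]-subset of the tuple the connectedness found in [H]. *)
Definition embedding_form k N (H : sgraph 'I_N) x y :=
  FAnd (fors [seq FAnd (FA (AEq (ev p.1) x)) (FA (AEq (ev p.2) y))
             | p : 'I_N * 'I_N <- edge_list H])
       (fands [seq signed (induced_connected H K)
                          (family_form k [seq ev (val i) | i <- enum K])
              | K : {set 'I_N} <- enum (ksets 'I_N k)]).

Definition large_form k N x y :=
  exs (names ev N) (FAnd (distinct (names ev N))
    (fors [seq embedding_form k H x y
          | H : sgraph 'I_N <- enum {: sgraph 'I_N} & connected_graph H && triangle_free H])).

Definition small_form N (E : {set 'I_N * 'I_N}) x y :=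
  fors [seq FAnd (FA (AEqC x p.1)) (FA (AEqC y p.2)) | p : 'I_N * 'I_N <- enum E].

(** * Meaning of the formulas on an instance *)

Section InstanceForms.
Variables (V : finType) (k : nat) (S T : {set {set V}}).
Hypothesis STk : complete_ksets k S T.
Local Notation inp := (encode_instance S T).
Local Notation rk := (@encode_vertex V).

Lemma sem_exs_vertices (v0 : V) s xs f : sem inp s (exs xs f) <->
  exists h : nat -> V, sem inp (set_vars s xs (fun x => rk (h x))) f.
Proof.
split=> [/sem_exs[g gn sf]|[h sf]]; last first.
  by apply/sem_exs; exists (fun x => rk (h x)) => // x _; apply: rk_lt.
exists (fun x => odflt v0 [pick v | rk v == g x]).
rewrite -(@sem_ext _ (set_vars s xs g)) // => y /=; case: ifP => // yxs.
case: pickP => [v /eqP <- //|none] /=.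
by have [v vE] := rk_surj (gn y yxs); have := none v; rewrite vE eqxx.
Qed.

Lemma sem_alls_vertices (v0 : V) s xs f : sem inp s (alls xs f) <->
  forall h : nat -> V, sem inp (set_vars s xs (fun x => rk (h x))) f.
Proof.
split=> [/= /negP none h|all].
  by apply/negPn/negP => nf; apply: none; apply/(sem_exs_vertices v0); exists h.
apply/negP => /(sem_exs_vertices v0)[h] /=; by rewrite all.
Qed.

Lemma name_function (v0 : V) (nm : nat -> nat) N (g : 'I_N -> V) : injective nm ->
  exists h : nat -> V, forall i : 'I_N, h (nm i) = g i.
Proof.
move=> nmI; exists (fun x => if [pick i : 'I_N | nm i == x] is Some i then g i else v0).
move=> i; case: pickP => [j /eqP/nmI/val_inj -> //|/(_ i)].
by rewrite eqxx.
Qed.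

Lemma mem_names (nm : nat -> nat) N (i : 'I_N) : nm i \in names nm N.
Proof. by apply: map_f; rewrite mem_enum inE. Qed.

Lemma sem_distinct_names s (nm : nat -> nat) N (g : 'I_N -> V) : injective nm ->
  (forall i : 'I_N, vars s (nm i) = rk (g i)) ->
  sem inp s (distinct (names nm N)) <-> injective g.
Proof.
move=> nmI sE; split=> [/sem_distinct inj i j gij|gI].
  apply/val_inj/nmI/inj; rewrite ?mem_names //.
  by rewrite !sE gij.
apply/sem_distinct => _ _ /mapP[i _ ->] /mapP[j _ ->].
by rewrite !sE => /rk_inj/gI ->.
Qed.

Lemma sem_family_names s (nm : nat -> nat) N (g : 'I_N -> V) (K : {set 'I_N}) :
  (forall i, nm i != 0) -> injective g -> #|K| = k ->
  (forall i : 'I_N, vars s (nm i) = rk (g i)) ->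
  sem inp s (family_form k [seq nm (val i) | i <- enum K]) = (g @: K \in S).
Proof.
move=> nm0 gI Kk sE; rewrite (family_formP STk (vs := map g (enum K))).
- congr (_ \in S); apply/setP => v; rewrite inE; apply/mapP/imsetP => [][i].
    by rewrite mem_enum => iK ->; exists i.
  by move=> iK ->; exists i; rewrite ?mem_enum.
- by apply/mapP => -[i _ /esym/eqP]; apply/negP.
- by rewrite -!map_comp; apply: eq_map => i /=; rewrite sE.
- by rewrite map_inj_uniq ?enum_uniq.
- by rewrite size_map -cardE.
Qed.

Lemma ov_inj : injective ov. Proof. by move=> i j; rewrite /ov; lia. Qed.
Lemma ev_inj : injective ev. Proof. by move=> i j; rewrite /ev; lia. Qed.

Section Check.
Variables (phi : nat -> nat -> formula) (a : rel nat).
Hypothesis phiP : forall s x y, odd x -> odd y ->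
  vars s x < #|V| -> vars s y < #|V| ->
  sem inp s (phi x y) = a (vars s x) (vars s y).

Definition vrel : rel V := fun u v => a (rk u) (rk v).
Local Notation G := (rel_graph vrel).

Definition simple_rel := [forall u, forall v, vrel u v ==> (u != v) && vrel v u].

Lemma simple_adj : simple_rel -> adj G =2 vrel.
Proof.
move=> /forallP h; have h' u v : vrel u v -> (u != v) && vrel v u.
  by move: (h u) => /forallP/(_ v)/implyP.
apply: adj_rel_graph => [u v|u].
  by apply/idP/idP => /h'/andP[].
by apply/negP => /h'; rewrite eqxx.
Qed.

Lemma phi_vertices s x y u v : odd x -> odd y ->
  vars s x = rk u -> vars s y = rk v -> sem inp s (phi x y) = vrel u v.
Proof. by move=> xo yo xu yv; rewrite phiP ?xu ?yv ?rk_lt. Qed.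

Lemma sem_simple_form (v0 : V) s : sem inp s (simple_form phi) = simple_rel.
Proof.
(* The variables [ov 0] and [ov 1] have the numbers 1 and 3. *)
have E (h : nat -> V) : let s' := set_vars s [:: ov 0; ov 1] (fun x => rk (h x)) in
    sem inp s' (fimp (phi (ov 0) (ov 1))
      (FAnd (FNot (FA (AEq (ov 0) (ov 1)))) (phi (ov 1) (ov 0)))) =
    (vrel (h 1) (h 3) ==> (h 1 != h 3) && vrel (h 3) (h 1)).
  move=> s'; rewrite sem_fimp [sem _ _ (FAnd _ _)]/=.
  rewrite (@phi_vertices s' (ov 0) (ov 1) (h 1) (h 3)) //.
  rewrite (@phi_vertices s' (ov 1) (ov 0) (h 3) (h 1)) //.
  by rewrite (inj_eq (@rk_inj V)).
apply/idP/forallP => [/(sem_alls_vertices v0) all u|all].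
  apply/forallP => v; have := all (fun x => if x == 1 then u else v).
  by rewrite E.
by apply/(sem_alls_vertices v0) => h; rewrite E; apply: (forallP (all (h 1))).
Qed.

Lemma sem_triangle_free_form (v0 : V) s : simple_rel ->
  sem inp s (triangle_free_form phi) = triangle_free G.
Proof.
move=> simp; have E (h : nat -> V) :
    let s' := set_vars s [:: ov 0; ov 1; ov 2] (fun x => rk (h x)) in
    sem inp s' (FNot (FAnd (phi (ov 0) (ov 1))
                           (FAnd (phi (ov 1) (ov 2)) (phi (ov 0) (ov 2))))) =
    ~~ [&& adj G (h 1) (h 3), adj G (h 3) (h 5) & adj G (h 1) (h 5)].
  move=> s'; rewrite [LHS]/= !simple_adj //.
  rewrite (@phi_vertices s' (ov 0) (ov 1) (h 1) (h 3)) //.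
  rewrite (@phi_vertices s' (ov 1) (ov 2) (h 3) (h 5)) //.
  by rewrite (@phi_vertices s' (ov 0) (ov 2) (h 1) (h 5)).
apply/idP/forallP => [/(sem_alls_vertices v0) all u|all].
  apply/forallP => v; apply/forallP => w.
  have := all (fun x => if x == 1 then u else if x == 3 then v else w).
  by rewrite E.
apply/(sem_alls_vertices v0) => h; rewrite E.
exact: (forallP (forallP (all (h 1)) (h 3))).
Qed.

Lemma step_path_connect u v p : simple_rel ->
  path (step inp a) (rk u) p -> last (rk u) p = rk v ->
  connect (induced_adj G [set: V]) u v.
Proof.
move=> simp; elim: p u => [|q p IHp] u /=; first by move=> _ /rk_inj ->.
case/andP=> /and3P[_ /rk_surj[w <-] uw] wp lastp.
apply: connect_trans (IHp w wp lastp); apply: connect1.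
by rewrite induced_adjE !inE simple_adj.
Qed.

Lemma connect_step_path u p : simple_rel ->
  path (induced_adj G [set: V]) u p -> path (step inp a) (rk u) (map rk p).
Proof.
move=> simp; elim: p u => //= w p IHp u /andP[/and3P[_ _ uw] wp].
by rewrite IHp // andbT /step /= !rk_lt; rewrite simple_adj in uw.
Qed.

Lemma sem_all_marked_form (v0 : V) s : simple_rel ->
  marks_sound inp a s -> marks_complete inp a #|V| s ->
  sem inp s all_marked_form = connected_graph G.
Proof.
move=> simp snd cmp.
have E (h : nat -> V) : sem inp (set_vars s [:: ov 0] (fun x => rk (h x)))
    (FA (AMark (ov 0))) = marked s (rk (h 1)) by [].
have [r r0] : exists r, rk r = 0.
  by apply: rk_surj; apply: leq_ltn_trans (rk_lt v0).
apply/idP/idP => [/(sem_alls_vertices v0) all|/induced_connectedP[_ cG]].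
  have rP v : connect (induced_adj G [set: V]) r v.
    have mv := all (fun=> v); rewrite E in mv.
    have [p sp lastp] := snd _ (rk_lt v) mv.
    by apply: (@step_path_connect r v p); rewrite ?r0.
  apply/induced_connectedP; split; first by apply/set0Pn; exists r.
  move=> u v _ _; apply: connect_trans (rP v).
  by rewrite induced_connect_sym.
apply/(sem_alls_vertices v0) => h; rewrite E; set v := h 1.
have /connectP[p sp ->] := cG r v (in_setT _) (in_setT _).
(* A path without repeated vertices has fewer than [#|V|] steps, so the rounds performed suffice. *)
case/shortenP: sp => q sq uq _.
have := cmp (map rk q); rewrite -r0 last_map; apply.
  exact: connect_step_path.
by rewrite size_map; have := max_card (mem (r :: q)); rewrite (card_uniqP uq) => /ltnW.
Qed.

Lemma sem_connected_form s (g : 'I_k -> V) : simple_rel -> injective g ->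
  (forall i : 'I_k, vars s (ov i) = rk (g i)) ->
  sem inp s (connected_form k phi) = induced_connected G (g @: [set: 'I_k]).
Proof.
move=> simp gI sE; rewrite -induced_connected_pullback //.
rewrite sem_fors has_map.
have E (i j : 'I_k) : sem inp s (phi (ov i) (ov j)) = adj (pullback g G) i j.
  rewrite adj_pullback simple_adj //; apply: phi_vertices; rewrite ?sE //.
    by rewrite /ov /= odd_double.
  by rewrite /ov /= odd_double.
apply/hasP/idP => [[K]|cP].
  rewrite mem_filter => /andP[cK _]; rewrite /= sem_fands all_map => /allP sub.
  apply: induced_connected_sub cK => i j ij; rewrite -E.
  by apply: (sub (i, j)); rewrite mem_filter ij mem_enum.
(* The disjunct that holds is the induced subgraph itself. *)
exists (pullback g G); first by rewrite mem_filter mem_enum andbT.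
rewrite /= sem_fands all_map; apply/allP => -[i j].
by rewrite mem_filter => /andP[ij _] /=; rewrite E.
Qed.

Lemma sem_consistent_form (v0 : V) s : simple_rel ->
  sem inp s (consistent_form k phi) = (connected_ksets k G == S).
Proof.
move=> simp; have E (h : nat -> V) (g : 'I_k -> V) :
    let s' := set_vars s (names ov k) (fun x => rk (h x)) in
    (forall i : 'I_k, h (ov i) = g i) ->
    sem inp s' (fimp (distinct (names ov k))
      (fiff (family_form k (names ov k)) (connected_form k phi))) <->
    (injective g ->
     (g @: [set: 'I_k] \in S) = induced_connected G (g @: [set: 'I_k])).
  move=> s' hg; have sE (i : 'I_k) : vars s' (ov i) = rk (g i).
    by rewrite /= mem_names hg.
  have dE := sem_distinct_names ov_inj sE; rewrite sem_fimp sem_fiff.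
  have fE : injective g -> sem inp s' (family_form k (names ov k)) =
      (g @: [set: 'I_k] \in S).
    by move=> gI; apply: sem_family_names; rewrite // cardsT card_ord.
  split=> [/implyP imp gI|imp].
    by have /eqP := imp (iffRL dE gI); rewrite fE // (sem_connected_form simp gI sE).
  apply/implyP => /dE gI; rewrite fE // (sem_connected_form simp gI sE).
  exact/eqP/imp.
have cardg (g : 'I_k -> V) : injective g -> #|g @: [set: 'I_k]| = k.
  by move=> gI; rewrite card_imset // cardsT card_ord.
apply/idP/eqP => [/(sem_alls_vertices v0) all|GS].
  apply/setP => K; rewrite !inE; have [Kk|nKk] := eqVneq #|K| k; last first.
    by apply/esym/negP => /(family_card STk) /eqP; apply/negP.
  pose g (i : 'I_k) : V := enum_val (cast_ord (esym Kk) i).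
  have gI : injective g by move=> i j /enum_val_inj/cast_ord_inj.
  have gK : g @: [set: 'I_k] = K.
    apply/eqP; rewrite eqEcard cardg // Kk leqnn andbT.
    by apply/subsetP => _ /imsetP[i _ ->]; apply: enum_valP.
  have [h hg] := name_function v0 g ov_inj.
  by have := iffLR (E h g hg) (all h) gI; rewrite gK => ->.
apply/(sem_alls_vertices v0) => h; apply/(E h (fun i => h (ov i)) (fun=> erefl)).
by move=> gI; rewrite -GS !inE cardg // eqxx.
Qed.

Definition valid_rel := [&& simple_rel, connected_graph G, triangle_free G &
                            connected_ksets k G == S].

Lemma sem_check_form s gd :
  marks_sound inp a s -> marks_complete inp a #|V| s ->
  sem inp s (check_form k gd phi) = sem inp s gd && valid_rel.
Proof.
move=> snd cmp.
rewrite -[LHS]/[&& sem inp s gd, 0 < #|V|, sem inp s (simple_form phi),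
  sem inp s all_marked_form, sem inp s (triangle_free_form phi) &
  sem inp s (consistent_form k phi)].
congr andb; have [V0|Vn] := posnP #|V|.
  rewrite /valid_rel /connected_graph /induced_connected.
  by rewrite -cards_eq0 cardsT V0 /= andbF.
have /card_gt0P[v0 _] := Vn; rewrite andTb.
rewrite (sem_simple_form v0) /valid_rel; have [simp|//] := boolP simple_rel.
rewrite (sem_all_marked_form v0) // (sem_triangle_free_form v0) //.
by rewrite (sem_consistent_form v0).
Qed.

End Check.

Definition large_spec N u v := exists (g : 'I_N -> V) (H : sgraph 'I_N),
  [/\ injective g, connected_graph H, triangle_free H,
      forall K : {set 'I_N}, #|K| = k -> (g @: K \in S) = induced_connected H K
    & exists i j, [/\ adj H i j, g i = u & g j = v]].

Lemma large_formP N s x y u v : odd x -> odd y ->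
  vars s x = rk u -> vars s y = rk v ->
  sem inp s (large_form k N x y) <-> large_spec N u v.
Proof.
move=> xo yo xu yv.
have E (h : nat -> V) (g : 'I_N -> V) (H : sgraph 'I_N) :
    let s' := set_vars s (names ev N) (fun x => rk (h x)) in
    (forall i : 'I_N, h (ev i) = g i) -> injective g ->
    sem inp s' (embedding_form k H x y) <->
    (forall K : {set 'I_N}, #|K| = k -> (g @: K \in S) = induced_connected H K) /\
    exists i j, [/\ adj H i j, g i = u & g j = v].
  move=> s' hg gI; have sE (i : 'I_N) : vars s' (ev i) = rk (g i).
    by rewrite /= mem_names hg.
  (* The tuple is stored in even variables, so [x] and [y] keep their values. *)
  have odd_var z : odd z -> vars s' z = vars s z.
    move=> zo /=; case: ifP => // /mapP[i _ zE]; move: zo.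
    by rewrite zE /ev /= odd_double.
  have fE (K : {set 'I_N}) : #|K| = k ->
      sem inp s' (family_form k [seq ev (val i) | i <- enum K]) = (g @: K \in S).
    by move=> Kk; apply: sem_family_names.
  rewrite /embedding_form [sem _ _ (FAnd _ _)]/=.
  rewrite -/(fors _) -[~~ _]/(sem inp s' (fors _)) sem_fors sem_fands has_map all_map.
  split=> [/andP[/hasP[[i j]] /[!mem_filter]/andP[ij _] eqs /allP con]|].
    split=> [K Kk|].
      have := con K; rewrite mem_enum inE Kk eqxx => /(_ isT) /=.
      by rewrite sem_signed fE // => /eqP.
    have [/eqP si /eqP sj] : vars s' (ev i) == vars s' x /\ vars s' (ev j) == vars s' y.
      exact/andP.
    exists i, j; split=> //; apply: rk_inj.
      by rewrite -sE si odd_var // xu.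
    by rewrite -sE sj odd_var // yv.
  case=> con [i [j [ij gi gj]]]; apply/andP; split.
    apply/hasP; exists (i, j); first by rewrite mem_filter ij mem_enum.
    rewrite -[X in is_true X]/((vars s' (ev i) == vars s' x) && (vars s' (ev j) == vars s' y)).
    by rewrite !sE !odd_var // gi gj xu yv !eqxx.
  apply/allP => K; rewrite mem_enum inE => /eqP Kk.
  by rewrite inE sem_signed fE // con.
split.
  case/(sem_exs_vertices u) => h; rewrite sem_and sem_fors has_map => /andP[ds].
  pose g (i : 'I_N) := h (ev i); set s' := set_vars _ _ _ in ds *.
  have sE (i : 'I_N) : vars s' (ev i) = rk (g i) by rewrite /= mem_names.
  have gI := iffLR (sem_distinct_names ev_inj sE) ds.
  case/hasP => H; rewrite mem_filter => /andP[/andP[cH tfH] _].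
  by case/(E h g H (fun=> erefl) gI) => con ij; exists g, H; split.
case=> g [H [gI cH tfH con ij]]; apply/(sem_exs_vertices u).
have [h hg] := name_function u g ev_inj; exists h; set s' := set_vars _ _ _.
have sE (i : 'I_N) : vars s' (ev i) = rk (g i) by rewrite /= mem_names hg.
rewrite sem_and; apply/andP; split; first exact/(sem_distinct_names ev_inj sE).
rewrite sem_fors has_map; apply/hasP; exists H.
  by rewrite mem_filter cH tfH mem_enum.
by apply/(E h g H hg gI).
Qed.

Lemma small_formP N (E : {set 'I_N * 'I_N}) s x y :
  sem inp s (small_form E x y) =
  [exists p in E, (vars s x == val p.1) && (vars s y == val p.2)].
Proof.
rewrite sem_fors has_map; apply/hasP/existsP => [][p].
  by rewrite mem_enum => pE eqs; exists p; rewrite pE.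
by case/andP=> pE eqs; exists p; rewrite ?mem_enum.
Qed.

(** A graph [H] carried by a tuple has the same connected [k]-sets as the subgraph of [G] induced
    there, hence equals it by uniqueness at order [large_order k]. Conversely, an edge of [G] grows
    to a connected set of exactly this order, whose induced subgraph serves as [H]. *)
Lemma large_specP (G : sgraph V) u v : 2 <= k -> large_order k <= #|V| ->
  connected_graph G -> triangle_free G -> connected_ksets k G = S ->
  large_spec (large_order k) u v <-> adj G u v.
Proof.
move=> k2 large cG tfG GS; set N := large_order k.
have conS (A : {set V}) : #|A| = k -> (A \in S) = induced_connected G A.
  by move=> Ak; rewrite -GS !inE Ak eqxx.
split=> [[g [H [gI cH tfH con [i [j [ij <- <-]]]]]]|uv].
  suff HE : H = pullback g G by rewrite HE adj_pullback in ij.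
  apply/esym/(connected_ksets_unique k2) => //.
  - by rewrite card_ord.
  - exact: triangle_free_pullback.
  - by move=> K Kk; rewrite induced_connected_pullback // -con // conS // card_imset.
have cuv : induced_connected G (v |: [set u]).
  by apply: induced_connectedU1 uv; rewrite ?induced_connected1 ?inE.
have N2 : 2 <= N.
  rewrite /N /large_order; have : 0 < k ^ 3 by rewrite expn_gt0; lia.
  by lia.
have [|||Y [cY uvY _ YN]] := induced_connected_grow cG cuv (m := N).
- exact: subsetT.
- by apply: leq_trans N2; rewrite cardsU1 cards1; case: (_ \notin _).
- by rewrite cardsT.
pose g (i : 'I_N) : V := enum_val (cast_ord (esym YN) i).
have gI : injective g by move=> i j /enum_val_inj/cast_ord_inj.
have gY : g @: [set: 'I_N] = Y.
  apply/eqP; rewrite eqEcard card_imset // cardsT card_ord YN leqnn andbT.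
  by apply/subsetP => _ /imsetP[i _ ->]; apply: enum_valP.
exists g, (pullback g G); split=> //.
- by rewrite /connected_graph induced_connected_pullback // gY.
- exact: triangle_free_pullback.
- by move=> K Kk; rewrite induced_connected_pullback // conS // card_imset.
have /imsetP[i _ iu] : u \in g @: [set: 'I_N].
  by rewrite gY (subsetP uvY) // !inE eqxx orbT.
have /imsetP[j _ jv] : v \in g @: [set: 'I_N].
  by rewrite gY (subsetP uvY) // !inE eqxx.
by exists i, j; split=> //; rewrite adj_pullback -iu -jv.
Qed.

End InstanceForms.

(** * Enumeration of the candidates *)

Section PolynomialBound.
Variable k : nat.

(** Here [b] stands for the input entries: [b 0] is the number of vertices and [b 1] the size of the
    family. The polynomial is fixed before the instance. *)
Definition poly_bounded (F : (nat -> nat) -> nat) :=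
  exists p : {poly nat}, forall b, b 1 <= b 0 ^ k -> F b <= (p.[b 0])%R.

Lemma poly_bounded_const c : poly_bounded (fun=> c).
Proof. by exists (c%:P)%R => b _; rewrite hornerC. Qed.

Lemma poly_bounded_add F F' : poly_bounded F -> poly_bounded F' ->
  poly_bounded (fun b => F b + F' b).
Proof.
move=> [p pP] [q qP]; exists (p + q)%R => b bk; rewrite hornerD.
exact: leq_add (pP b bk) (qP b bk).
Qed.

Lemma poly_bounded_mul F F' : poly_bounded F -> poly_bounded F' ->
  poly_bounded (fun b => F b * F' b).
Proof.
move=> [p pP] [q qP]; exists (p * q)%R => b bk; rewrite hornerM.
exact: leq_mul (pP b bk) (qP b bk).
Qed.

Lemma poly_bounded_entry (j : bool) : poly_bounded (fun b => b j).
Proof.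
case: j; last by exists 'X%R => b _; rewrite hornerX.
by exists ('X^k)%R => b bk; rewrite hornerXn natrXE.
Qed.

Lemma poly_bounded_for (j : bool) F : poly_bounded F ->
  poly_bounded (fun b => for_time (b j) (F b)).
Proof.
move=> FP; apply/poly_bounded_add/poly_bounded_const.
apply/poly_bounded_mul/poly_bounded_add/poly_bounded_const => //.
exact: poly_bounded_entry.
Qed.

Lemma poly_bounded_form f : poly_bounded (form_time^~ f).
Proof.
elim: f => [a|g IHg|g IHg h IHh|x j g IHg] /=.
- exact: poly_bounded_const.
- exact/poly_bounded_add/poly_bounded_const.
- by apply/poly_bounded_add/poly_bounded_const/poly_bounded_add.
apply/poly_bounded_add/poly_bounded_const/poly_bounded_for.
exact/poly_bounded_add/poly_bounded_const.
Qed.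

Lemma poly_bounded_process phi chk : poly_bounded (fun b => process_time b phi chk).
Proof.
have c := poly_bounded_const; have f := poly_bounded_form.
have add F F' := @poly_bounded_add F F'; have loop F := @poly_bounded_for false F.
apply: (add _ _ (add _ _ (add _ _ (loop _ (c 3)) (c 3)) _) (add _ _ (f chk) _)).
  exact: loop _ (loop _ (loop _ (add _ _ (f _) (c 6)))).
exact: add _ _ (loop _ (loop _ (add _ _ (f _) (c 7)))) (c 4).
Qed.

End PolynomialBound.

(** [None] is the graph defined by [large_form], for at least [N] vertices; [Some E] is an explicit
    adjacency relation for fewer vertices. *)
Definition candidate N := option {set 'I_N * 'I_N}.

Definition candidate_form k N (c : candidate N) x y :=
  if c is Some E then small_form E x y else large_form k N x y.

(* The last conjunct makes distinct small candidates distinct graphs. *)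
Definition candidate_guard N (c : candidate N) :=
  if c is Some E then
    FAnd (FNot (FA (AGtC N.-1)))
         (fands [seq FAnd (FA (AGtC p.1)) (FA (AGtC p.2)) | p : 'I_N * 'I_N <- enum E])
  else FA (AGtC N.-1).

Definition candidate_check k N (c : candidate N) :=
  check_form k (candidate_guard c) (candidate_form k c).

Definition process_all k N (cs : seq (candidate N)) :=
  foldr (fun c => CSeq (process (candidate_form k c) (candidate_check k c))) CSkip cs.

Definition process_all_time b k N (cs : seq (candidate N)) :=
  foldr (fun c t => process_time b (candidate_form k c) (candidate_check k c) + t) 1 cs.

Lemma poly_bounded_process_all k N (cs : seq (candidate N)) :
  poly_bounded k (fun b => process_all_time b k cs).
Proof.
elim: cs => [|c cs IHcs] /=; first exact: poly_bounded_const.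
exact/poly_bounded_add/IHcs/poly_bounded_process.
Qed.

(** * Correctness of the enumeration *)

Section Enumeration.
Variables (V : finType) (k N : nat) (S T : {set {set V}}).
Hypothesis STk : complete_ksets k S T.
Local Notation inp := (encode_instance S T).
Local Notation rk := (@encode_vertex V).
Implicit Type c : candidate N.

(** The variables 1 and 3 are a sample choice; [candidate_formP] shows that any odd variables give
    the same relation. *)
Definition candidate_rel c : rel nat := fun p q =>
  sem inp (set_var (set_var init_state 1 p) 3 q) (candidate_form k c 1 3).

Local Notation vr c := (@vrel V (candidate_rel c)).

Lemma candidate_rel_large u v :
  candidate_rel None (rk u) (rk v) <-> large_spec k S N u v.
Proof. exact: large_formP. Qed.

Lemma candidate_formP c s x y : odd x -> odd y ->
  vars s x < #|V| -> vars s y < #|V| ->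
  sem inp s (candidate_form k c x y) = candidate_rel c (vars s x) (vars s y).
Proof.
move=> xo yo /rk_surj[u xu] /rk_surj[v yv]; rewrite -xu -yv.
case: c => [E|]; first by rewrite /candidate_rel !small_formP /= -xu -yv.
have lP := large_formP STk N xo yo (esym xu) (esym yv).
by apply/idP/idP => [/lP/candidate_rel_large|/candidate_rel_large/lP].
Qed.

Definition candidate_ok c :=
  if c is Some E then (#|V| <= N.-1) && [forall p in E, (p.1 < #|V|) && (p.2 < #|V|)]
  else N.-1 < #|V|.

Lemma candidate_guardP c s : sem inp s (candidate_guard c) = candidate_ok c.
Proof.
case: c => [E|] //=; rewrite sem_fands all_map -leqNgt; congr andb.
apply/allP/forall_inP => h p pE; last by apply: h; rewrite -mem_enum.
by apply: h; rewrite mem_enum.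
Qed.

Definition good_candidate c := candidate_ok c && @valid_rel V k S (candidate_rel c).

Lemma map_rk_enum : map rk (enum V) = iota 0 #|V|.
Proof.
apply: (@eq_from_nth _ 0) => [|i]; rewrite size_map -cardE ?size_iota // => iV.
have [v0 _] := rk_surj iV; rewrite (nth_map v0) -?cardE // nth_iota //.
by rewrite /encode_vertex -(enum_val_nth v0 (Ordinal iV)) enum_valK.
Qed.

Lemma encode_rel_graph a : @simple_rel V a ->
  encode_graph (rel_graph (vrel (V := V) a)) =
  [seq nat_of_bool (a i j) | i <- iota 0 #|V|, j <- iota 0 #|V|].
Proof.
move=> simp; rewrite -map_rk_enum allpairs_mapl allpairs_mapr.
by apply: eq_allpairs => u v; rewrite simple_adj.
Qed.

Lemma process_allP cs out :
  hoare inp (fun s => output s = out) (process_all k cs)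
    (process_all_time (nth 0 inp) k cs)
    (fun s => output s = out ++
       encode_graphs [seq rel_graph (vr c) | c <- cs & good_candidate c]).
Proof.
elim: cs out => [|c cs IHcs] out.
  have skip := @hoare_skip inp (fun s => output s = out).
  by apply: hoare_weaken skip _ _ _ => // s ->; rewrite cats0.
have pP := @processP inp _ _ (@candidate_formP c) (candidate_check k c) out.
pose out' := out ++
  encode_graphs (if good_candidate c then [:: rel_graph (vr c)] else [::]).
apply: (@hoare_seq _ (fun s => output s = out')).
  apply: hoare_weaken pP _ (leqnn _) _ => // s [s1 [snd cmp ->]]; congr (_ ++ _).
  rewrite (sem_check_form STk (@candidate_formP c)) // candidate_guardP.
  rewrite -/(good_candidate c); case: ifP => // /andP[_ /and4P[simp _ _ _]].
  by rewrite /encode_graphs /= cats0 encode_rel_graph.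
apply: hoare_weaken (IHcs out') _ (leqnn _) _ => // s ->.
rewrite /out' -catA /encode_graphs -flatten_cat -map_cat; congr (_ ++ flatten (map _ _)).
by rewrite /=; case: ifP.
Qed.

(** The number of vertices decides whether a good candidate is [None]. For an explicit one the guard
    keeps all pairs of [E] below the number of vertices, so the graph determines [E]. *)
Lemma good_candidate_inj : {in good_candidate &, injective (fun c => rel_graph (vr c))}.
Proof.
move=> c c' /andP[ok /and4P[simp _ _ _]] /andP[ok' /and4P[simp' _ _ _]] GE.
have relE p q : p < #|V| -> q < #|V| -> candidate_rel c p q = candidate_rel c' p q.
  move=> /rk_surj[u <-] /rk_surj[v <-]; rewrite -/(vr c u v) -/(vr c' u v).
  by rewrite -!simple_adj // GE.
case: c c' ok ok' relE {simp simp' GE} => [E|] [E'|] //=; try by lia.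
case/andP=> _ /forall_inP EV /andP[_ /forall_inP EV'] relE; congr Some.
have relP (F : {set 'I_N * 'I_N}) (p : 'I_N * 'I_N) :
    candidate_rel (Some F) p.1 p.2 = (p \in F).
  rewrite /candidate_rel /candidate_form small_formP /=; apply/existsP/idP => [[q]|pF].
    by case: p q => [i j] [i' j'] /= /and3P[qF /eqP/val_inj -> /eqP/val_inj ->].
  by exists p; rewrite pF !eqxx.
apply/setP => p; apply/idP/idP => pE.
  by have /andP[p1 p2] := EV p pE; rewrite -relP -relE // relP.
by have /andP[p1 p2] := EV' p pE; rewrite -relP relE // relP.
Qed.

(** Both pairs of families partition the [k]-sets, so equality of the first components forces that
    of the second. *)
Lemma consistentE (G : sgraph V) :
  consistent k S T G <-> connected_ksets k G = S.
Proof.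
split=> [[] //|GS]; split=> //; apply/setP => A.
case: STk => /setP/(_ A) + /setP/(_ A); rewrite -GS !inE.
by case: (_ == _); case: induced_connected => /=; case: (A \in T).
Qed.

Lemma vrel_adj c (G : sgraph V) : vr c =2 adj G ->
  connected_graph G -> triangle_free G -> connected_ksets k G = S ->
  rel_graph (vr c) = G /\ @valid_rel V k S (candidate_rel c).
Proof.
move=> cG conG tfG GS; have simp : @simple_rel V (candidate_rel c).
  apply/forallP => u; apply/forallP => v; rewrite !cG adj_sym.
  by apply/implyP => vu; rewrite vu eq_sym (adj_neq vu).
have GE : rel_graph (vr c) = G by apply: sgraph_ext => u v; rewrite simple_adj // cG.
by split=> //; rewrite /valid_rel simp GE conG tfG GS eqxx.
Qed.

End Enumeration.

Theorem theorem4 (k : nat) (hk : 2 <= k) :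
  exists (P : cmd) (p : {poly nat}),
    forall (V : finType) (S T : {set {set V}}),
      complete_ksets k S T ->
      exists (Gs : seq (sgraph V)) (t : nat),
        [/\ runs P (encode_instance S T) t (encode_graphs Gs),
            t <= (p.[#|V|])%R,
            uniq Gs
          & forall G : sgraph V,
              G \in Gs <->
              [/\ connected_graph G, triangle_free G & consistent k S T G]].
Proof.
pose N := large_order k; pose cs := enum {: candidate N}.
have N_gt0 : 0 < N by rewrite muln_gt0 expn_gt0; lia.
have [p pP] := poly_bounded_process_all k cs.
exists (process_all k cs), p => V S T STk.
pose inp := encode_instance S T.
pose Gs := [seq rel_graph (@vrel V (candidate_rel k S T c))
           | c <- cs & good_candidate k S T c].
have [t [s [ex le out]]] := process_allP STk cs (erefl : output init_state = [::]).
exists Gs, t; split; first by exists s.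
(* Entries 0 and 1 of the input are [#|V|] and [#|S|], so the condition in [poly_bounded] is
   [family_size]. *)
- by apply: leq_trans le (pP (nth 0 inp) _); apply: family_size STk.
- rewrite map_inj_in_uniq => [|c c']; first exact/filter_uniq/enum_uniq.
  rewrite !mem_filter => /andP[gc _] /andP[gc' _].
  exact: good_candidate_inj gc gc'.
move=> G; split.
  case/mapP => c; rewrite mem_filter => /andP[/andP[_ /and4P[_ cG tfG /eqP GS]] _] ->.
  by split=> //; apply/(consistentE STk).
case=> cG tfG /(consistentE STk) GS; apply/mapP.
have [large|small] := leqP N #|V|.
  have rE : @vrel V (candidate_rel k S T (None : candidate N)) =2 adj G.
    move=> u v; have lP := large_specP u v hk large cG tfG GS.
    by apply/idP/idP => [/(candidate_rel_large N STk)/lP|/lP/(candidate_rel_large N STk)].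
  have [GE val] := vrel_adj rE cG tfG GS; exists None => //.
  by rewrite mem_filter mem_enum andbT /good_candidate val andbT /= prednK.
(* For fewer than [N] vertices all vertex numbers are below [N], and the adjacency relation of [G],
   written in these numbers, is one of the explicit candidates. *)
pose E := [set q : 'I_N * 'I_N | [exists u, exists v,
  [&& adj G u v, encode_vertex u == q.1 & encode_vertex v == q.2]]].
have rE : @vrel V (candidate_rel k S T (Some E)) =2 adj G.
  move=> u v; rewrite /vrel /candidate_rel /candidate_form small_formP /=.
  apply/existsP/idP => [[q]|uv].
    rewrite inE => /and3P[/existsP[u' /existsP[v' /and3P[uv]]]].
    by move=> /eqP <- /eqP <- /eqP/rk_inj -> /eqP/rk_inj ->.
  have ltN w : @encode_vertex V w < N by apply: ltn_trans (rk_lt w) small.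
  exists (Ordinal (ltN u), Ordinal (ltN v)); rewrite !eqxx inE !andbT.
  by apply/existsP; exists u; apply/existsP; exists v; rewrite uv !eqxx.
have [GE val] := vrel_adj rE cG tfG GS; exists (Some E) => //.
rewrite mem_filter mem_enum andbT /good_candidate val andbT /=.
apply/andP; split; first by rewrite -ltnS prednK.
apply/forall_inP => q; rewrite inE => /existsP[u /existsP[v /and3P[_]]].
by move=> /eqP <- /eqP <-; rewrite !rk_lt.
Qed.
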